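(* Let $\lambda_0\in\mathbb{D}\setminus\{0\}$ and let $x=(a,b,p)\in\mathbb{E}$. The following conditions are equivalent: (1) there exists an analytic function $\varphi:\mathbb{D}\to\overline{\mathbb{E}}$ such that $\varphi(0)=(0,0,0)$ and $\varphi(\lambda_0)=x$; (1$'$) there exists an analytic function $\varphi:\mathbb{D}\to\mathbb{E}$ such that $\varphi(0)=(0,0,0)$ and $\varphi(\lambda_0)=x$; (2) $$\max\left\{\frac{|a-\bar b p|+|ab-p|}{1-|b|^2},\ \frac{|b-\bar a p|+|ab-p|}{1-|a|^2}\right\}\le|\lambda_0|;$$ (3) either $|b|\le|a|$ and $\dfrac{|a-\bar b p|+|ab-p|}{1-|b|^2}\le|\lambda_0|$, or $|a|\le|b|$ and $\dfrac{|b-\bar a p|+|ab-p|}{1-|a|^2}\le|\lambda_0|$; (4) there exists a function $F$ in the $2\times2$ Schur class such that $F(0)=\begin{bmatrix}0&*\\0&0\end{bmatrix}$ (the entry $*$ being unspecified) and $F(\lambda_0)=A=[a_{ij}]$ for some matrix $A$ with $x=(a_{11},a_{22},\det A)$.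
   Context: $\mathbb{D}$ is the open unit disc in $\mathbb{C}$. The tetrablock is the domain $\mathbb{E}=\{x\in\mathbb{C}^3: 1-x_1z-x_2w+x_3zw\ne0 \text{ whenever } |z|\le1,\ |w|\le1\}$, and $\overline{\mathbb{E}}$ is its closure in $\mathbb{C}^3$. The $2\times2$ Schur class is the set of analytic functions $F:\mathbb{D}\to\mathbb{C}^{2\times2}$ with $\|F(\lambda)\|\le1$ for all $\lambda\in\mathbb{D}$, where $\|\cdot\|$ is the operator norm (largest singular value). *)

(* Defs.v *)
From HB Require Import structures.
From mathcomp Require Import all_boot all_order all_algebra.
From mathcomp Require Import all_classical all_reals all_analysis.
From mathcomp Require Import complex.

Set Implicit Arguments.
Unset Strict Implicit.
Unset Printing Implicit Defensive.

Import Order.TTheory GRing.Theory Num.Theory.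
Import numFieldNormedType.Exports.

Local Open Scope classical_set_scope.
Local Open Scope ring_scope.

(* R[i] seen as a numClosedFieldType: MathComp-Analysis attaches the metric
   topology and the normed-module structure over itself to (abstract) number
   fields, not to the bare carrier R[i]. *)
Definition Cplx (R : realType) : numClosedFieldType := R[i].

Section Tetrablock.
Variable R : realType.
Local Notation C := (Cplx R).

(* The usual modulus with values in R; `|z| : C is its embedding in C. *)
Definition cmod (z : C) : R := ComplexField.Normc.normc z.

Definition unit_disc : set C := [set z | cmod z < 1].

(* Functions on the unit disc are represented by total functions on C whose
   values off the disc are irrelevant: derivability at a point of the (open)
   disc, in the complex direction 1 with limits taken in C, is complex
   differentiability and only depends on the values near that point. *)
Definition analytic_on_disc (V : normedModType C) (f : C -> V) : Prop :=
  forall z, unit_disc z -> derivable f z 1.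

Definition triple (a b p : C) : 'rV[C]_3 := \row_(j < 3) [:: a; b; p]`_j.

Definition tetrablock : set 'rV[C]_3 :=
  [set x | forall z w : C, cmod z <= 1 -> cmod w <= 1 ->
     1 - x 0 0 * z - x 0 1 * w + x 0 2 * z * w != 0].

Definition l2norm n (v : 'cV[C]_n) : R := Num.sqrt (\sum_i cmod (v i 0) ^+ 2).

Definition opnorm m n (A : 'M[C]_(m, n)) : R :=
  sup [set l2norm (A *m v) | v in [set v | l2norm v <= 1]].

Definition schur_class (F : C -> 'M[C]_2) : Prop :=
  analytic_on_disc F /\ forall z, unit_disc z -> opnorm (F z) <= 1.

End Tetrablock.

(* Main.v *)
Require Import Defs.
From HB Require Import structures.
From mathcomp Require Import all_boot all_order all_algebra.
From mathcomp Require Import all_classical all_reals all_analysis.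
From mathcomp Require Import complex.
From mathcomp Require Import ring lra.

Set Implicit Arguments.
Unset Strict Implicit.
Unset Printing Implicit Defensive.

Import Order.TTheory GRing.Theory Num.Theory.
Import numFieldNormedType.Exports.

Local Open Scope classical_set_scope.
Local Open Scope ring_scope.

(* Everything rests on Schwarz's lemma, which is derived from bare complex
   differentiability.  Midpoint sums over the boundary of a square are exactly
   additive under dyadic subdivision and vanish on affine functions, so
   Goursat's argument shows that they tend to 0.  Applied to
   (h - h(w0))^2 / (w - w0), this bounds |h(w0)| by a constant multiple of the
   maximum of |h| on the boundary.  The constant is harmless: the bound is used
   for h = f^(n+1) / z^n, transported to the upper half-plane by the Cayley
   transform, with n and then the square going to infinity.

   A point (x1, x2, x3) is in the tetrablock iff |x1 - x3 w| < |1 - x2 w| for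
   all |w| <= 1.  Schwarz's lemma for (phi1 - phi3 w) / (1 - phi2 w) gives (1')
   and, on choosing w optimally, (2).  Conversely, under (3) one may shrink l0
   until the inequality is an equality; the interpolating function is then
   G(l) diag(Y, om) with Y = sig l, u = rho l, |om| = 1 and
   G = [1 - k, sqrt k (1 - u); sqrt k (1 - u), (1 - k) u] / (1 - k u),
   and |b| <= |a| is what makes |rho| <= 1 and k <= 1. *)

(** * Real part, imaginary part and real-valued modulus *)

Section ComplexModulus.
Variable R : realType.
Local Notation C := (Cplx R).
Implicit Types (z w : C) (x y : R).

Definition rc x : C := real_complex R x.
Definition re z : R := complex.Re z.
Definition im z : R := complex.Im z.
Definition ii : C := Complex 0 1.

Lemma normE z : `|z| = rc (cmod z).
Proof. by []. Qed.

Lemma rcD x y : rc (x + y) = rc x + rc y.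
Proof. exact: (rmorphD (real_complex R)). Qed.
Lemma rcB x y : rc (x - y) = rc x - rc y.
Proof. exact: (rmorphB (real_complex R)). Qed.
Lemma rcM x y : rc (x * y) = rc x * rc y.
Proof. exact: (rmorphM (real_complex R)). Qed.
Lemma rc0 : rc 0 = 0. Proof. by []. Qed.
Lemma rc1 : rc 1 = 1. Proof. by []. Qed.
Lemma rcV x : rc x^-1 = (rc x)^-1.
Proof. exact: (fmorphV (real_complex R)). Qed.
Lemma rcX x n : rc (x ^+ n) = rc x ^+ n.
Proof. exact: (rmorphXn (real_complex R)). Qed.
Lemma rc_nat n : rc n%:R = n%:R.
Proof. exact: (rmorph_nat (real_complex R)). Qed.
Lemma rc_inj : injective rc.
Proof. exact: complexI. Qed.
Lemma rc_eq0 x : (rc x == 0) = (x == 0).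
Proof. by rewrite -rc0 (inj_eq rc_inj). Qed.
Lemma ler_rc x y : (rc x <= rc y) = (x <= y).
Proof. exact: lecR. Qed.
Lemma ltr_rc x y : (rc x < rc y) = (x < y).
Proof. exact: ltcR. Qed.

Lemma reD z w : re (z + w) = re z + re w.
Proof. by case: z; case: w. Qed.
Lemma imD z w : im (z + w) = im z + im w.
Proof. by case: z; case: w. Qed.
Lemma reN z : re (- z) = - re z.
Proof. by case: z. Qed.
Lemma imN z : im (- z) = - im z.
Proof. by case: z. Qed.
Lemma reM z w : re (z * w) = re z * re w - im z * im w.
Proof. by case: z; case: w. Qed.
Lemma imM z w : im (z * w) = re z * im w + im z * re w.
Proof. by case: z; case: w. Qed.
Lemma re_rc x : re (rc x) = x. Proof. by []. Qed.
Lemma im_rc x : im (rc x) = 0. Proof. by []. Qed.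
Lemma re_ii : re ii = 0. Proof. by []. Qed.
Lemma im_ii : im ii = 1. Proof. by []. Qed.
Lemma reimE z : z = rc (re z) + ii * rc (im z).
Proof. exact: complexE. Qed.
Lemma eq_reim z w : re z = re w -> im z = im w -> z = w.
Proof. by case: z; case: w => ? ? ? ? /= -> ->. Qed.
Lemma re_conj z : re z^* = re z.
Proof. by case: z. Qed.
Lemma im_conj z : im z^* = - im z.
Proof. by case: z. Qed.

Definition reimS := (reD, imD, reN, imN, reM, imM, re_rc, im_rc, re_ii, im_ii,
  re_conj, im_conj).

Lemma cmod_ge0 z : 0 <= cmod z.
Proof. by rewrite -ler_rc -normE rc0. Qed.
Lemma cmodM z w : cmod (z * w) = cmod z * cmod w.
Proof. exact: ComplexField.Normc.normcM. Qed.
Lemma cmodV z : cmod z^-1 = (cmod z)^-1.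
Proof. exact: ComplexField.Normc.normcV. Qed.
Lemma cmod0 : cmod (0 : C) = 0.
Proof. exact: ComplexField.Normc.normc0. Qed.
Lemma cmod1 : cmod (1 : C) = 1.
Proof. exact: ComplexField.Normc.normc1. Qed.
Lemma cmodX z n : cmod (z ^+ n) = cmod z ^+ n.
Proof. by elim: n => [|n IH]; rewrite ?expr0 ?cmod1 // !exprS cmodM IH. Qed.
Lemma cmod_eq0 z : (cmod z == 0) = (z == 0).
Proof. by rewrite -(rc_eq0 (cmod z)) -normE normr_eq0. Qed.
Lemma cmod_gt0 z : (0 < cmod z) = (z != 0).
Proof. by rewrite lt_def cmod_ge0 andbT cmod_eq0. Qed.
Lemma cmodD z w : cmod (z + w) <= cmod z + cmod w.
Proof. by rewrite -ler_rc rcD -!normE ler_normD. Qed.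
Lemma cmodN z : cmod (- z) = cmod z.
Proof. by apply: rc_inj; rewrite -!normE normrN. Qed.
Lemma cmod_rc x : cmod (rc x) = `|x|.
Proof. by rewrite /cmod /= expr0n /= addr0 sqrtr_sqr. Qed.
Lemma cmodJ z : cmod z^* = cmod z.
Proof. by apply: rc_inj; rewrite -!normE norm_conjC. Qed.
Lemma cmodCK z : rc (cmod z ^+ 2) = z * z^*.
Proof. by rewrite rcX -normE normCK. Qed.
Lemma cmod_reim z : cmod z ^+ 2 = re z ^+ 2 + im z ^+ 2.
Proof. by case: z => x y; rewrite sqr_sqrtr // addr_ge0 ?sqr_ge0. Qed.
Lemma cmod_ii : cmod ii = 1.
Proof. by rewrite /cmod /= expr0n expr1n add0r sqrtr1. Qed.
Lemma cmodB_ge z w : cmod z - cmod w <= cmod (z - w).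
Proof. by rewrite lerBlDr -{1}(subrK w z) cmodD. Qed.

Lemma ler_cmod_sqr z w : (cmod z <= cmod w) = (cmod z ^+ 2 <= cmod w ^+ 2).
Proof. by rewrite ler_pXn2r ?nnegrE ?cmod_ge0. Qed.
Lemma ltr_cmod_sqr z w : (cmod z < cmod w) = (cmod z ^+ 2 < cmod w ^+ 2).
Proof. by rewrite ltr_pXn2r ?nnegrE ?cmod_ge0. Qed.

Lemma re_le_cmod z : `|re z| <= cmod z.
Proof.
rewrite -(@ler_pXn2r _ 2) ?nnegrE ?cmod_ge0 // real_normK ?num_real //.
by rewrite cmod_reim lerDl sqr_ge0.
Qed.
Lemma im_le_cmod z : `|im z| <= cmod z.
Proof.
rewrite -(@ler_pXn2r _ 2) ?nnegrE ?cmod_ge0 // real_normK ?num_real //.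
by rewrite cmod_reim lerDr sqr_ge0.
Qed.
Lemma cmod_le_reim z : cmod z <= `|re z| + `|im z|.
Proof.
rewrite {1}(reimE z) (le_trans (cmodD _ _)) //.
by rewrite cmodM cmod_ii mul1r !cmod_rc.
Qed.

End ComplexModulus.

(** * Rules for complex derivability *)

Section ComplexDifferentiation.
Variable R : realType.
Local Notation C := (Cplx R).
Local Notation rc := (@rc R).
Implicit Types (f g phi : C -> C) (z w c : C).

(** Radii and tolerances in the topology of [C] are elements of [C]; Goursat's argument needs the
    first-order expansion with real ones. Written without division, it also covers [h = 0]. *)
Lemma derivable_eps phi z : derivable phi z 1 -> exists l : C,
  forall e : R, 0 < e -> exists2 del : R, 0 < del &
    forall h, cmod h < del -> cmod (phi (z + h) - phi z - l * h) <= e * cmod h.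
Proof.
move=> /cvg_ex[l /cvgrPdist_le /= phil]; exists l => e e0.
have := phil (rc e); rewrite -rc0 ltr_rc => /(_ e0).
rewrite /dnbhs/= /within/= nearE/= => /nbhs_ballP[/= d].
rewrite /= => d0 dP.
(* In the order of [C], a positive element is real. *)
have d_real : d = rc (re d).
  by apply: eq_reim => //; rewrite im_rc; apply: ger0_Im (ltW d0).
exists (re d); first by rewrite -ltr_rc -d_real.
move=> h hd; have [->|h0] := eqVneq h 0.
  by rewrite addr0 mulr0 subr0 subrr cmod0 mulr0.
have hb : `|0 - h : C| < d by rewrite sub0r normrN normE d_real ltr_rc.
have := dP h hb h0; rewrite -[_ <= _]/(rc (cmod
  (l - h^-1 * (phi (h * 1 + z) - phi z))) <= rc e) ler_rc mulr1 => H.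
rewrite -(ler_pM2r (_ : 0 < cmod h^-1)); last by rewrite cmod_gt0 invr_eq0.
rewrite -cmodM (_ : (_ - _ * h) * h^-1 = - (l - h^-1 * (phi (h + z) - phi z))).
  by rewrite cmodN -mulrA cmodV mulfV ?mulr1 // cmod_eq0.
by rewrite opprB mulrBl mulfK // (addrC z) [h^-1 * _]mulrC.
Qed.

(* Midpoint sum over [2 ^ n] pieces; midpoint tags make it exact on affine
   functions, so that no integral has to be constructed. *)
Lemma derivable_compC f g z :
  derivable g z 1 -> derivable f (g z) 1 -> derivable (fun w => f (g w)) z 1.
Proof.
move=> /derivable1_diffP gz /derivable1_diffP fz.
by apply/derivable1_diffP; exact: (differentiable_comp gz fz).
Qed.

Lemma derivable_expr f n z :
  derivable f z 1 -> derivable (fun w => f w ^+ n) z 1.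
Proof.
move=> fz; by have := @derivableX _ _ f n z 1 fz; rewrite exprfctE.
Qed.

Lemma derivable_subr z c : derivable (fun w : C => w - c) z 1.
Proof. by apply: derivableB; [exact: derivable_id | exact: derivable_cst]. Qed.

Lemma derivable_cstE w z : derivable (fun=> w : C) z 1.
Proof. exact: derivable_cst. Qed.

Lemma derivable_subE f g z : derivable f z 1 -> derivable g z 1 ->
  derivable (fun u => f u - g u) z 1.
Proof. by move=> fz gz; exact: (derivableB fz gz). Qed.

Lemma derivable_mulE f g z : derivable f z 1 -> derivable g z 1 ->
  derivable (fun u => f u * g u) z 1.
Proof. by move=> fz gz; exact: (derivableM fz gz). Qed.

Lemma derivable_divE f g z : derivable f z 1 -> derivable g z 1 -> g z != 0 ->
  derivable (fun u => f u / g u) z 1.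
Proof. by move=> fz gz gz0; apply: derivable_mulE fz _; exact: derivableV. Qed.

(* Removable singularity: the difference quotient of [f ^+ n.+1 / (w - c) ^+ n]
   at [c] is the [n.+1]-th power of that of [f]. *)
Lemma derivable_powdiv_center f n c : derivable f c 1 -> f c = 0 ->
  derivable (fun w => f w ^+ n.+1 / (w - c) ^+ n) c 1.
Proof.
move=> fc f0; pose q (h : C) : C := h^-1 * (f (h * 1 + c) - f c).
have qX m : cvg (q h ^+ m @[h --> 0^']).
  elim: m => [|m IH]; first by apply: (@is_cvg_cst C).
  rewrite (_ : (fun h => q h ^+ m.+1) = q \* (fun h => q h ^+ m)).
    exact: (is_cvgM fc IH).
  by apply/funext => h; rewrite exprS.
have := qX n.+1.
move/cvg_ex => [l ql]; apply/cvg_ex; exists l.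
apply: cvg_trans ql; apply: near_eq_cvg.
near=> h; have h0 : h != 0 by near: h; exact: nbhs_dnbhs_neq.
rewrite /q /= f0 !subr0 expr0n mul0r subr0 mulr1 [h *: 1]mulr1 addrK.
rewrite -![_ *: _]/(_ * _) exprMn exprVn exprS; field.
by rewrite h0 expf_neq0.
Unshelve. all: by end_near. Qed.

Lemma derivable_powdiv f n c z : derivable f z 1 -> f c = 0 ->
  derivable (fun w => f w ^+ n.+1 / (w - c) ^+ n) z 1.
Proof.
have [->|zc fz _] := eqVneq z c; first exact: derivable_powdiv_center.
apply: derivableM; first exact: derivable_expr.
apply: derivableV; last exact/derivable_expr/derivable_subr.
by rewrite expf_neq0 // subr_eq0.
Qed.

Lemma derivable_mx_entry m n (F : C -> 'M[C]_(m.+1, n.+1)) z i j :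
  derivable F z 1 -> derivable (fun w => F w i j) z 1.
Proof.
move=> /derivable1_diffP Fz; apply/derivable1_diffP.
exact: (differentiable_comp Fz (@differentiable_coord _ _ _ _ i j)).
Qed.

Lemma derivable_mx m n (F : C -> 'M[C]_(m.+1, n.+1)) z :
  (forall i j, derivable (fun w => F w i j) z 1) -> derivable F z 1.
Proof.
move=> FD; apply/derivable1_diffP.
have -> : F = \sum_i \sum_j (fun w => F w i j *: delta_mx i j).
  apply/funext => w; rewrite fct_sumE [LHS]matrix_sum_delta.
  by apply: eq_bigr => i _; rewrite fct_sumE.
apply: differentiable_sum => i; apply: differentiable_sum => j.
by apply: differentiableZl; apply/derivable1_diffP; exact: FD.
Qed.

End ComplexDifferentiation.

(** * Boundary sums over squares and Goursat's bisection *)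

Section Goursat.
Variable R : realType.
Local Notation C := (Cplx R).
Local Notation rc := (@rc R).
Local Notation ii := (ii R).
Implicit Types (f g phi : C -> C) (z w d : C) (x y : R).

(** Riemann sum for the integral of [phi] along the segment from [z] to [z + d], with [2 ^ n] equal
    pieces tagged at their midpoints. *)
Fixpoint segsum phi n z d : C :=
  if n is n'.+1 then segsum phi n' z (d / 2) + segsum phi n' (z + d / 2) (d / 2)
  else phi (z + d / 2) * d.

(** Counterclockwise sum around the square with lower left corner [z] and side [d]: bottom and right
    forwards, top and left backwards. *)
Definition bdsum phi n z d : C :=
  segsum phi n z d + segsum phi n (z + d) (ii * d)
  - segsum phi n (z + ii * d) d - segsum phi n z (ii * d).

Lemma segsum_affine a b n z d :
  segsum (fun w => a + b * w) n z d = a * d + b * (z * d + d ^+ 2 / 2).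
Proof.
by elim: n z d => [|n IH] z d /=; rewrite ?IH; field.
Qed.

Lemma bdsum_affine a b n z d : bdsum (fun w => a + b * w) n z d = 0.
Proof. by rewrite /bdsum !segsum_affine; field. Qed.

Lemma segsumD f g n z d :
  segsum (fun w => f w + g w) n z d = segsum f n z d + segsum g n z d.
Proof. by elim: n z d => [|n IH] z d /=; rewrite ?IH; ring. Qed.

Lemma bdsumD f g n z d :
  bdsum (fun w => f w + g w) n z d = bdsum f n z d + bdsum g n z d.
Proof. by rewrite /bdsum !segsumD; ring. Qed.

Lemma segsumZ k f n z d : segsum (fun w => k * f w) n z d = k * segsum f n z d.
Proof. by elim: n z d => [|n IH] z d /=; rewrite ?IH; ring. Qed.

Lemma bdsumZ k f n z d : bdsum (fun w => k * f w) n z d = k * bdsum f n z d.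
Proof. by rewrite /bdsum !segsumZ; ring. Qed.

(** The edges shared by two of the four quarters are traversed once in each direction and cancel.
    One level of refinement is spent on halving the outer sides. *)
Lemma bdsumS phi n z d : bdsum phi n.+1 z d =
  bdsum phi n z (d / 2) + bdsum phi n (z + d / 2) (d / 2)
  + bdsum phi n (z + ii * (d / 2)) (d / 2)
  + bdsum phi n (z + (d / 2 + ii * (d / 2))) (d / 2).
Proof.
rewrite /bdsum /=.
have -> : ii * d / 2 = ii * (d / 2) by rewrite mulrA.
have dE : d = d / 2 + d / 2 by field.
set e := d / 2 in dE *; rewrite dE mulrDr !addrA.
(* [ring] treats each segment sum as an atom, so the starting points of shared edges must first
   agree syntactically. *)
rewrite !(addrAC _ (ii * e) e) !(addrAC _ (ii * e) (ii * e)).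
by ring.
Qed.

Lemma half_rc z : z / 2 = rc 2^-1 * z.
Proof. by rewrite rcV rc_nat mulrC. Qed.

Lemma segsum_eq f g n z d :
  (forall x, 0 <= x <= 1 -> f (z + rc x * d) = g (z + rc x * d)) ->
  segsum f n z d = segsum g n z d.
Proof.
elim: n z d => [|n IH] z d fg /=.
  by rewrite !half_rc fg // invr_ge0 ler0n invf_le1 // ler1n.
congr (_ + _); apply: IH => x /andP[x0 x1].
- rewrite (_ : rc x * _ = rc (x / 2) * d); last by rewrite rcM rcV rc_nat; ring.
  by apply: fg; lra.
- rewrite (_ : z + _ + _ = z + rc ((1 + x) / 2) * d); last first.
    by rewrite rcM rcV rcD rc1 !rc_nat; field.
  by apply: fg; lra.
Qed.

Lemma segsum_bound B phi n z d :
  (forall x, 0 <= x <= 1 -> cmod (phi (z + rc x * d)) <= B) ->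
  cmod (segsum phi n z d) <= B * cmod d.
Proof.
elim: n z d => [|n IH] z d phiB /=.
  rewrite cmodM ler_wpM2r ?cmod_ge0 // half_rc phiB //.
  by rewrite invr_ge0 ler0n invf_le1 // ler1n.
have d2 : cmod (d / 2) = cmod d / 2.
  by rewrite cmodM cmodV -rc_nat cmod_rc ger0_norm.
rewrite (splitr (B * _)) -mulrA -d2 (le_trans (cmodD _ _)) // lerD // IH //.
- move=> x /andP[x0 x1].
  rewrite (_ : rc x * _ = rc (x / 2) * d); last by rewrite rcM rcV rc_nat; ring.
  by apply: phiB; lra.
- move=> x /andP[x0 x1].
  rewrite (_ : z + _ + _ = z + rc ((1 + x) / 2) * d); last first.
    by rewrite rcM rcV rcD rc1 !rc_nat; field.
  by apply: phiB; lra.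
Qed.

Definition in_square z (d : R) w :=
  (0 <= re (w - z) <= d) /\ (0 <= im (w - z) <= d).

Definition on_square z (d : R) w := in_square z d w /\
  [\/ re (w - z) = 0, re (w - z) = d, im (w - z) = 0 | im (w - z) = d].

Lemma on_square_sides z (d : R) x : 0 <= d -> 0 <= x <= 1 ->
  [/\ on_square z d (z + rc x * rc d),
      on_square z d (z + rc d + rc x * (ii * rc d)),
      on_square z d (z + ii * rc d + rc x * rc d) &
      on_square z d (z + rc x * (ii * rc d))].
Proof.
move=> d0 /andP[x0 x1].
have xd : 0 <= x * d <= d by rewrite mulr_ge0 // ler_piMl.
split; rewrite /on_square /in_square !reimS.
- by split; [split; lra | apply: Or43; lra].
- by split; [split; lra | apply: Or42; lra].
- by split; [split; lra | apply: Or44; lra].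
- by split; [split; lra | apply: Or41; lra].
Qed.

Lemma bdsum_bound B phi n z (d : R) : 0 <= d ->
  (forall w, on_square z d w -> cmod (phi w) <= B) ->
  cmod (bdsum phi n z (rc d)) <= 4 * B * d.
Proof.
move=> d0 phiB.
have S u v : cmod v = d ->
    (forall x, 0 <= x <= 1 -> on_square z d (u + rc x * v)) ->
    cmod (segsum phi n u v) <= B * d.
  by move=> vd H; rewrite -vd; apply: segsum_bound => x xI; apply/phiB/H.
have cd : cmod (rc d) = d by rewrite cmod_rc ger0_norm.
have cid : cmod (ii * rc d) = d by rewrite cmodM cmod_ii mul1r.
rewrite /bdsum; set a1 := segsum _ _ _ _; set a2 := segsum _ _ _ _.
set a3 := segsum _ _ _ _; set a4 := segsum _ _ _ _.
have h1 : cmod a1 <= B * d by apply: S => // x /(on_square_sides z d0)[].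
have h2 : cmod a2 <= B * d by apply: S => // x /(on_square_sides z d0)[].
have h3 : cmod a3 <= B * d by apply: S => // x /(on_square_sides z d0)[].
have h4 : cmod a4 <= B * d by apply: S => // x /(on_square_sides z d0)[].
have := cmodD (a1 + a2 - a3) (- a4); have := cmodD (a1 + a2) (- a3).
have := cmodD a1 a2; rewrite !cmodN; lra.
Qed.

Lemma bdsum_eq f g n z (d : R) : 0 <= d ->
  (forall w, on_square z d w -> f w = g w) ->
  bdsum f n z (rc d) = bdsum g n z (rc d).
Proof.
move=> d0 fg; rewrite /bdsum.
rewrite !(@segsum_eq f g) // => x /(on_square_sides z d0)[];
  by move=> *; apply: fg.
Qed.

(** The supremum of the left ends works: every right end is an upper bound of all left ends. *)
Lemma nested_intervals (x d : nat -> R) : (forall n, 0 <= d n) ->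
  (forall n, x n <= x n.+1 /\ x n.+1 + d n.+1 <= x n + d n) ->
  exists t, forall n, x n <= t <= x n + d n.
Proof.
move=> d0 xd.
have xm m n : (m <= n)%N -> x m <= x n /\ x n + d n <= x m + d m.
  elim: n => [|n IH]; first by rewrite leqn0 => /eqP ->.
  rewrite leq_eqVlt => /orP[/eqP -> //|/IH [h1 h2]].
  by have [h3 h4] := xd n; split; lra.
have ub n : ubound (range x) (x n + d n).
  move=> _ [m _ <-]; have [mn|/ltnW nm] := leqP m n.
    by have [] := xm _ _ mn; have := d0 n; lra.
  by have [] := xm _ _ nm; have := d0 m; lra.
have hs : has_sup (range x).
  by split; [exists (x 0%N), 0%N | exists (x 0%N + d 0%N); exact: ub].
exists (sup (range x)) => n; apply/andP; split.
  by apply: (sup_upper_bound hs); exists n.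
by apply: ge_sup; [exists (x 0%N), 0%N | exact: ub].
Qed.

Lemma geometric_small (d e : R) : 0 < e -> exists n : nat, d / 2 ^+ n < e.
Proof.
move=> e0; exists (Num.Def.archi_bound (d / e)).
by rewrite ltr_pdivrMr ?exprn_gt0 // mulrC -ltr_pdivrMr // upper_nthrootP.
Qed.

(** A triple [(x, y, d)] encodes a square by its corner and side. The bound is proportional to the
    area, so that the bounds for four quarters add up to the bound for the whole; the factor 8 is
    four sides times a diameter estimate of [2 * d]. *)
Definition small_bdsum phi (e : R) (q : R * R * R) :=
  let: (x, y, d) := q in exists N, forall n, (N <= n)%N ->
    cmod (bdsum phi n (rc x + ii * rc y) (rc d)) <= 8 * e * d ^+ 2.

Definition half_square (q q' : R * R * R) :=
  let: (x, y, d) := q in let: (x', y', d') := q' in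
  [/\ d' = d / 2, x' = x \/ x' = x + d / 2 & y' = y \/ y' = y + d / 2].

Lemma small_bdsum_half phi e q :
  (forall q', half_square q q' -> small_bdsum phi e q') -> small_bdsum phi e q.
Proof.
case: q => [[x y] d] H.
have [N1 h1] : small_bdsum phi e (x, y, d / 2) by apply: H; split; auto.
have [N2 h2] : small_bdsum phi e (x + d / 2, y, d / 2) by apply: H; split; auto.
have [N3 h3] : small_bdsum phi e (x, y + d / 2, d / 2) by apply: H; split; auto.
have [N4 h4] : small_bdsum phi e (x + d / 2, y + d / 2, d / 2).
  by apply: H; split; auto.
(* The successor pays for the level that [bdsumS] consumes. *)
exists (maxn (maxn N1 N2) (maxn N3 N4)).+1 => -[//|n].
rewrite ltnS !geq_max.
move=> /andP[/andP[/h1 {}h1 /h2 {}h2] /andP[/h3 {}h3 /h4 {}h4]].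
rewrite bdsumS (_ : rc d / 2 = rc (d / 2)); last by rewrite rcM rcV rc_nat.
move: h1 h2 h3 h4; set e2 := d / 2; rewrite !rcD.
rewrite (_ : rc x + rc e2 + ii * rc y = rc x + ii * rc y + rc e2); last by ring.
rewrite (_ : rc x + ii * (rc y + rc e2) =
  rc x + ii * rc y + ii * rc e2); last by ring.
rewrite (_ : rc x + rc e2 + ii * (rc y + rc e2) =
  rc x + ii * rc y + (rc e2 + ii * rc e2)); last by ring.
set a1 := bdsum _ _ _ _; set a2 := bdsum _ _ _ _.
set a3 := bdsum _ _ _ _; set a4 := bdsum _ _ _ _ => h1 h2 h3 h4.
have := cmodD (a1 + a2 + a3) a4; have := cmodD (a1 + a2) a3.
have := cmodD a1 a2.
have -> : d ^+ 2 = 4 * e2 ^+ 2 by rewrite /e2; field.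
lra.
Qed.

Lemma in_square_diam z (d : R) w w' : in_square z d w -> in_square z d w' ->
  cmod (w - w') <= 2 * d.
Proof.
rewrite /in_square !(reD, reN, imD, imN).
move=> [/andP[w1 w2] /andP[w3 w4]] [/andP[c1 c2] /andP[c3 c4]].
apply: (le_trans (cmod_le_reim _)); rewrite !(reD, reN, imD, imN).
have : `|re w - re w'| <= d by rewrite ler_norml; lra.
have : `|im w - im w'| <= d by rewrite ler_norml; lra.
lra.
Qed.

(** A square violating the bound has a quarter violating it. Iterating yields squares shrinking to a
    point [c], where derivability makes the bound true on a small enough square, a contradiction. *)
Lemma goursat phi z (d e : R) : 0 < d -> 0 < e ->
  (forall w, in_square z d w -> derivable phi w 1) ->
  exists N, forall n, (N <= n)%N -> cmod (bdsum phi n z (rc d)) <= e.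
Proof.
move=> d0 e0 phiD; pose eps := e / (8 * d ^+ 2).
have eps0 : 0 < eps by rewrite divr_gt0 // mulr_gt0 // exprn_gt0.
suff [N hN] : small_bdsum phi eps (re z, im z, d).
  exists N => n Nn; have := hN n Nn.
  have <- : z = rc (re z) + ii * rc (im z) by exact: reimE.
  rewrite (_ : 8 * eps * _ = e) // /eps.
  by field; rewrite gt_eqF.
apply: contrapT => nS.
(* Dependent choice needs a total relation; hence badness of [q] is a premise of the relation, and a
   good square is related to itself. *)
have [Q [Q0 QS]] : {Q : nat -> R * R * R | Q 0%N = (re z, im z, d) /\ forall n,
    ~ small_bdsum phi eps (Q n) ->
    half_square (Q n) (Q n.+1) /\ ~ small_bdsum phi eps (Q n.+1)}.
  apply: (@dependent_choice _ (fun q q' => ~ small_bdsum phi eps q ->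
    half_square q q' /\ ~ small_bdsum phi eps q')) => q; apply: cid.
  apply: contrapT => H; apply: (H); exists q => nq; exfalso; apply: nq.
  apply: small_bdsum_half => q' qq'; apply: contrapT => nq'.
  by apply: H; exists q'.
have nQ n : ~ small_bdsum phi eps (Q n) by elim: n => [|n /QS[]//]; rewrite Q0.
pose x n := (Q n).1.1; pose y n := (Q n).1.2; pose s n := (Q n).2.
have QE n : Q n = (x n, y n, s n) by rewrite /x /y /s; case: (Q n) => [[]].
have H n : [/\ s n.+1 = s n / 2, x n.+1 = x n \/ x n.+1 = x n + s n / 2 &
    y n.+1 = y n \/ y n.+1 = y n + s n / 2].
  by have [] := QS n (nQ n); rewrite /half_square !QE.
have sE n : s n = d / 2 ^+ n.
  elim: n => [|n IH]; first by rewrite /s Q0 expr0 divr1.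
  by case: (H n) => -> _ _; rewrite IH exprS; field; rewrite expf_neq0.
have s0 n : 0 < s n by rewrite sE divr_gt0 // exprn_gt0.
have [u uP] : exists t, forall n, x n <= t <= x n + s n.
  apply: nested_intervals => n; first exact: ltW.
  by have := s0 n; case: (H n) => -> [] -> _; lra.
have [v vP] : exists t, forall n, y n <= t <= y n + s n.
  apply: nested_intervals => n; first exact: ltW.
  by have := s0 n; case: (H n) => -> _ [] ->; lra.
pose c : C := rc u + ii * rc v.
have cQ n : in_square (rc (x n) + ii * rc (y n)) (s n) c.
  by rewrite /in_square /c !reimS; have := uP n; have := vP n; split; lra.
have [l lP] : exists l : C, forall e : R, 0 < e -> exists2 del : R, 0 < del &
    forall h, cmod h < del -> cmod (phi (c + h) - phi c - l * h) <= e * cmod h.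
  apply: derivable_eps; apply: phiD; have := cQ 0%N.
  have [-> -> ->] : [/\ x 0%N = re z, y 0%N = im z & s 0%N = d].
    by rewrite /x /y /s Q0.
  have <- : z = rc (re z) + ii * rc (im z) by exact: reimE.
  by [].
have [del del0 delP] := lP _ eps0.
have del2 : 0 < del / 2 by rewrite divr_gt0.
have [n] := geometric_small d del2; rewrite -sE => sn.
apply: (nQ n); rewrite QE; exists 0%N => m _.
(* [A + l * w] is the tangent map at [c]. Its boundary sum is zero, and the remainder is at most
   [eps * (2 * s n)] on the square, whence [8 * eps * s n ^+ 2]. *)
set a := _ + _; pose A := phi c - l * c.
rewrite (@bdsum_eq phi (fun w => (A + l * w) + (phi w - (A + l * w)))).
- rewrite bdsumD bdsum_affine add0r.
  rewrite (le_trans (@bdsum_bound (eps * (2 * s n)) _ _ _ _ _ _))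
    ?(ltW (s0 n)) //.
  + move=> w [wa _].
    have wc := in_square_diam wa (cQ n).
    have := delP (w - c) (le_lt_trans wc _).
    rewrite (_ : 2 * s n < del); last by lra.
    move=> /(_ isT); rewrite (addrC c) subrK.
    rewrite (_ : phi w - phi c - l * (w - c) = phi w - (A + l * w)); last first.
      by rewrite /A; ring.
    by move/le_trans; apply; rewrite ler_pM2l.
  + by rewrite le_eqVlt; apply/orP; left; apply/eqP; ring.
- exact: ltW.
- by move=> w _; ring.
Qed.

End Goursat.

(** * A Cauchy estimate with an unspecified constant *)

Section CrudeCauchy.
Variable R : realType.
Local Notation C := (Cplx R).
Local Notation rc := (@rc R).
Local Notation ii := (ii R).
Implicit Types (g phi : C -> C) (z w : C) (x d e : R).

Lemma reV z : re z^-1 = re z / cmod z ^+ 2.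
Proof. by rewrite cmod_reim; case: z. Qed.
Lemma imV z : im z^-1 = - im z / cmod z ^+ 2.
Proof. by rewrite cmod_reim; case: z => x y /=; rewrite mulNr. Qed.

(** The segment sum is an average of values of [phi * u], so a pointwise lower bound survives. *)
Lemma segsum_im_ge b phi n z (u : C) :
  (forall x, 0 <= x <= 1 -> b <= im (phi (z + rc x * u) * u)) ->
  b <= im (segsum phi n z u).
Proof.
elim: n b z u => [|n IH] b z u phib /=.
  by rewrite [u / 2]half_rc phib // invr_ge0 ler0n invf_le1 // ler1n.
have half (v : C) : im (v * (u / 2)) = im (v * u) / 2.
  by rewrite mulrA -rc_nat -rcV !reimS mulr0 add0r.
rewrite imD (splitr b); apply: lerD; apply: IH => x /andP[x0 x1].
- rewrite half ler_pM2r ?invr_gt0 // (_ : rc x * _ = rc (x / 2) * u).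
    by apply: phib; lra.
  by rewrite rcM rcV rc_nat; ring.
- rewrite half ler_pM2r ?invr_gt0 // (_ : z + _ + _ = z + rc ((1 + x) / 2) * u).
    by apply: phib; lra.
  by rewrite rcM rcV rcD rc1 rc_nat; field.
Qed.

Definition deep_in z d e w :=
  (e <= re (w - z) <= d - e) /\ (e <= im (w - z) <= d - e).

Lemma on_square_dist z d e w w0 : 0 < e -> deep_in z d e w0 ->
  on_square z d w ->
  e <= cmod (w - w0) <= 2 * d.
Proof.
move=> e0 w0I wI; apply/andP; split; last first.
  apply: (in_square_diam wI.1); move: w0I; rewrite /deep_in /in_square; lra.
have := re_le_cmod (w - w0); have := im_le_cmod (w - w0); move: w0I wI.
rewrite /deep_in /on_square /in_square !(reD, reN, imD, imN).
have := ler_norm (re w - re w0); have := ler_norm (im w - im w0).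
have := lerNnormlW (lexx `|re w - re w0|).
have := lerNnormlW (lexx `|im w - im w0|).
by move=> ? ? ? ? [/andP[? ?] /andP[? ?]] [_ [] H] ? ?; lra.
Qed.

(** Stands in for the exact value of the contour integral, 2 pi i. Going counterclockwise, the
    argument of [w - w0] increases along every side, so all four sides contribute positively to the
    imaginary part. *)
Lemma bdsum_inv_ge z d e w0 n : 0 < d -> 0 < e -> deep_in z d e w0 ->
  e / d <= cmod (bdsum (fun w => (w - w0)^-1) n z (rc d)).
Proof.
move=> d0 e0 w0I.
apply: le_trans (im_le_cmod _); apply: le_trans (ler_norm _).
(* Lower bound for one side: the relevant coordinate of [w - w0] is at least [e] in absolute value,
   the modulus at most [2 * d], the length [d]. *)
pose b := e / (4 * d ^+ 2) * d.
have -> : e / d = b + b + b + b by rewrite /b; field; rewrite gt_eqF.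
have key w x : on_square z d w -> e <= x -> b <= x / cmod (w - w0) ^+ 2 * d.
  move=> wS ex; have /andP[h1 h2] := on_square_dist e0 w0I wS.
  rewrite /b ler_pM2r // ler_pM ?(ltW e0) //.
    by rewrite invr_ge0 mulr_ge0 ?sqr_ge0.
  rewrite lef_pV2 ?posrE ?exprn_gt0 ?mulr_gt0 ?exprn_gt0 //; last lra.
  rewrite (_ : 4 * _ = (2 * d) ^+ 2); last by ring.
  by rewrite ler_pXn2r ?nnegrE ?cmod_ge0 // mulr_ge0 // ltW.
have N g m u v : - segsum g m u v = segsum (fun w => -1 * g w) m u v.
  by rewrite segsumZ mulN1r.
have S := on_square_sides z (ltW d0).
rewrite /bdsum !N !imD.
move: w0I; rewrite /deep_in !(reD, reN, imD, imN).
move=> -[/andP[i1 i2] /andP[i3 i4]].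
have rcdM (v : C) : im (v * rc d) = im v * d by rewrite !reimS mulr0 add0r.
have rcidM (v : C) : im (v * (ii * rc d)) = re v * d.
  by rewrite !reimS; ring.
apply: lerD; first apply: lerD; first apply: lerD; apply: segsum_im_ge => x xI;
  have [s1 s2 s3 s4] := S _ xI.
- rewrite rcdM imV; apply: key => //.
  by rewrite !reimS; lra.
- rewrite rcidM reV; apply: key => //.
  by rewrite !reimS; lra.
- rewrite rcdM mulN1r imN imV !mulNr opprK; apply: key => //.
  by rewrite !reimS; lra.
- rewrite rcidM mulN1r reN reV -mulNr; apply: key => //.
  by rewrite !reimS; lra.
Qed.

(** If [X] exceeded [(2 * K + 1) * M], then [X ^+ 2] would exceed [2 * K * X * M + X * M], and
    [X * M] is at least [K * M ^+ 2]. *)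
Lemma le_of_sqr_le (X M K : R) : 0 <= X -> 0 <= M -> 0 <= K ->
  X ^+ 2 <= K * (2 * X * M + M ^+ 2) -> X <= (2 * K + 1) * M.
Proof.
move=> X0 M0 K0 H; rewrite leNgt; apply/negP => lt.
have KM0 := mulr_ge0 K0 M0.
have XP : 0 < X by lra.
have : K * M * M <= X * M by rewrite ler_wpM2r //; lra.
have : (2 * K + 1) * M * X < X * X by rewrite ltr_pM2r.
by move: H; rewrite !expr2; lra.
Qed.

(* [K] does not depend on [h], so that the bound can be applied to powers. *)
Lemma crude_cauchy z d e w0 : 0 < d -> 0 < e -> deep_in z d e w0 ->
  exists2 K, 0 <= K & forall h M, 0 <= M ->
    (forall w, in_square z d w -> derivable h w 1) ->
    (forall w, on_square z d w -> cmod (h w) <= M) -> cmod (h w0) <= K * M.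
Proof.
move=> d0 e0 w0I; pose K := 4 * d ^+ 2 / e ^+ 2.
have K0 : 0 <= K by rewrite divr_ge0 ?sqr_ge0 // mulr_ge0 // sqr_ge0.
(* [K] is what remains of [4 * B * d] against [X ^+ 2 * (e / d)] below, once [2 * X * M + M ^+ 2] is
   factored out. *)
exists (2 * K + 1) => [|h M M0 hD hM]; first lra.
have X0 := cmod_ge0 (h w0); apply: le_of_sqr_le => //.
set X := cmod (h w0) in X0 *.
pose B := (2 * X * M + M ^+ 2) / e.
have B0 : 0 <= B.
  by rewrite divr_ge0 ?(ltW e0) // addr_ge0 ?sqr_ge0 // !mulr_ge0.
suff H : X ^+ 2 * (e / d) <= 4 * B * d.
  rewrite -(@ler_pM2r _ (e / d)) ?divr_gt0 // (le_trans H) //.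
  rewrite le_eqVlt; apply/orP; left; apply/eqP; rewrite /B /K; field.
  by rewrite !gt_eqF.
rewrite leNgt; apply/negP => lt.
pose eps := X ^+ 2 * (e / d) - 4 * B * d.
(* Squaring the numerator makes the quotient derivable at [w0] too, so that Goursat applies on the
   whole square. *)
pose g w := (h w - h w0) ^+ 2 / (w - w0) ^+ 1.
have [|w wI|N gN] := @goursat R g z d (eps / 2) d0.
- by rewrite divr_gt0 // subr_gt0.
- apply: (@derivable_powdiv _ (fun w => h w - h w0) 1); last by rewrite subrr.
  by apply: derivableB; [exact: hD | exact: derivable_cst].
have := gN N (leqnn N).
(* Expanding the square isolates [h w0 ^+ 2 / (w - w0)], whose sum is large by [bdsum_inv_ge]; the
   other terms involve [h w] and are controlled by [M]. *)
rewrite (@bdsum_eq _ g (fun w => h w0 ^+ 2 * (w - w0)^-1 +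
  (- 2 * h w0 * h w + h w ^+ 2) / (w - w0))) ?(ltW d0) //; last first.
  by move=> w _; rewrite /g expr1; ring.
rewrite bdsumD bdsumZ; set J := bdsum _ _ _ _; set E := bdsum _ _ _ _ => le1.
have J1 : e / d <= cmod J by exact: bdsum_inv_ge.
have E1 : cmod E <= 4 * B * d.
  apply: bdsum_bound; first exact: ltW.
  move=> w wS; rewrite cmodM cmodV /B.
  have /andP[h1 _] := on_square_dist e0 w0I wS.
  apply: ler_pM; rewrite ?invr_ge0 ?cmod_ge0 //.
    rewrite (le_trans (cmodD _ _)) // cmodX !cmodM cmodN -rc_nat cmod_rc.
    rewrite ger0_norm // lerD //.
      by rewrite ler_wpM2l ?mulr_ge0 // hM.
    by rewrite ler_pXn2r ?nnegrE ?cmod_ge0 // hM.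
  by rewrite lef_pV2 ?posrE // (lt_le_trans e0).
have := cmodB_ge (h w0 ^+ 2 * J) (- E); rewrite opprK cmodN cmodM cmodX -/X.
have : X ^+ 2 * (e / d) <= X ^+ 2 * cmod J by rewrite ler_wpM2l ?sqr_ge0.
by move: le1 E1 lt; rewrite /eps; lra.
Qed.

End CrudeCauchy.

(** * Schwarz's lemma by way of the upper half-plane *)

Section Schwarz.
Variable R : realType.
Local Notation C := (Cplx R).
Local Notation rc := (@rc R).
Local Notation ii := (ii R).
Implicit Types (f : C -> C) (z w l : C) (x y : R).

Lemma expr_unbounded x y : 1 < x -> exists n : nat, y < x ^+ n.
Proof.
move=> x1; have bern n : 1 + n%:R * (x - 1) <= x ^+ n.
  elim: n => [|n IH]; first by rewrite mul0r addr0 expr0.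
  rewrite exprS -natr1; have n0 : 0 <= n%:R :> R by rewrite ler0n.
  have : x * (1 + n%:R * (x - 1)) <= x * x ^+ n by rewrite ler_pM2l //; lra.
  have : 0 <= n%:R * (x - 1) * (x - 1) by rewrite !mulr_ge0 //; lra.
  lra.
have x10 : 0 < x - 1 by rewrite subr_gt0.
pose n := Num.Def.archi_bound (`|y| / (x - 1)); exists n.
have : `|y| / (x - 1) < n%:R by apply: archi_boundP; rewrite divr_ge0 // ltW.
rewrite ltr_pdivrMr // => lt; have := bern n; have := ler_norm y; lra.
Qed.

(** Takes the upper half-plane onto the disc. A large square there, with its bottom close to the
    real axis, has its whole boundary sent close to the unit circle. *)
Definition cayley w : C := (w - ii) / (w + ii).

Lemma cayley_den w : 0 < im w -> w + ii != 0.
Proof.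
move=> w0; apply/eqP => /(congr1 (@im R)); rewrite imD im_ii => H.
by move: H; rewrite -[im 0]/(0 : R); lra.
Qed.

Lemma derivable_cayley w : 0 < im w -> derivable cayley w 1.
Proof.
move=> w0; apply: derivableM; first exact: derivable_subr.
apply: derivableV; first exact: cayley_den.
by apply: derivableD; [exact: derivable_id | exact: derivable_cst].
Qed.

Lemma cmod_cayley_sqr w : 0 < im w ->
  (1 - cmod (cayley w) ^+ 2) * cmod (w + ii) ^+ 2 = 4 * im w.
Proof.
move=> w0; have wi : cmod (w + ii) != 0 by rewrite cmod_eq0 cayley_den.
rewrite mulrBl /cayley cmodM cmodV exprMn exprVn mulfVK ?expf_neq0 // mul1r.
by rewrite !cmod_reim !(reD, imD, reN, imN, re_ii, im_ii); ring.
Qed.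

Lemma cayley_disc w : 0 < im w -> unit_disc (cayley w).
Proof.
move=> w0; rewrite /unit_disc /= -[1](@cmod1 R) ltr_cmod_sqr cmod1 expr1n.
have := cmod_cayley_sqr w0.
have : 0 < cmod (w + ii) ^+ 2 by rewrite exprn_gt0 // cmod_gt0 cayley_den.
move=> p H; rewrite ltNge; apply/negP => le.
have : (1 - cmod (cayley w) ^+ 2) * cmod (w + ii) ^+ 2 <= 0.
  by apply: mulr_le0_ge0; [lra | exact: ltW].
lra.
Qed.

Lemma cayley_surj l : unit_disc l -> exists2 w, 0 < im w & cayley w = l.
Proof.
rewrite /unit_disc /= => l1.
have l10 : 1 - l != 0.
  apply/eqP => /eqP; rewrite subr_eq0 => /eqP H; move: l1.
  by rewrite -H cmod1 ltxx.
exists (ii * ((1 + l) / (1 - l))).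
  have -> : im (ii * ((1 + l) / (1 - l))) =
      (1 - cmod l ^+ 2) / cmod (1 - l) ^+ 2.
    rewrite imM re_ii im_ii mul0r mul1r add0r reM reV imV (cmod_reim l).
    rewrite !(reD, imD, reN, imN) -rc1 re_rc im_rc; ring.
  apply: divr_gt0; last by rewrite exprn_gt0 // cmod_gt0.
  by rewrite subr_gt0 expr_lt1 // cmod_ge0.
have i0 : ii != 0 by rewrite -cmod_gt0 cmod_ii.
rewrite /cayley; field; rewrite l10 (_ : _ + _ = ii * 2); last by ring.
by rewrite mulf_neq0 // pnatr_eq0.
Qed.

(** If [cmod (f l) > cmod l], some [q < 1] still has [q * cmod (f l) > cmod l]. On a square whose
    boundary is sent outside radius [q], the function [f ^ (n + 1) / z ^ n] has boundary values at
    most [q ^ (- n)]. The resulting estimate at [l] makes the powers of a number above 1 bounded, as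
    [K] is independent of [n]. *)
Lemma schwarz f : (forall z, unit_disc z -> derivable f z 1) ->
  (forall z, unit_disc z -> cmod (f z) <= 1) -> f 0 = 0 ->
  forall l, unit_disc l -> cmod (f l) <= cmod l.
Proof.
move=> fD f1 f0 l l1; have [->|ln0] := eqVneq l 0; first by rewrite f0.
rewrite leNgt; apply/negP => lt.
have lp : 0 < cmod l by rewrite cmod_gt0.
have fp : 0 < cmod (f l) by lra.
have [w0 w0i w0l] := cayley_surj l1.
pose q := (cmod l / cmod (f l) + 1) / 2.
have lf1 : cmod l / cmod (f l) < 1 by rewrite ltr_pdivrMr // mul1r.
have lf0 : 0 < cmod l / cmod (f l) by rewrite divr_gt0.
have q0 : 0 < q by rewrite /q; lra.
have q1 : q < 1 by rewrite /q; lra.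
have ql : 1 < q * cmod (f l) / cmod l.
  rewrite ltr_pdivlMr // mul1r -ltr_pdivrMr // /q; lra.
pose eta := 1 - q ^+ 2.
have eta0 : 0 < eta by rewrite subr_gt0 expr_lt1 // ltW.
(* The square has corner [- L + i del] and side [2 * L]. The bottom side needs [4 * del <= eta], the
   other three [4 <= eta * L]; the remaining terms keep [w0] inside with margin [e]. *)
pose del := Num.min (eta / 4) (im w0 / 2).
pose L := 4 / eta + cmod w0 + 1.
pose e := Num.min (im w0 / 2) 1.
have del0 : 0 < del by rewrite lt_min !divr_gt0.
have e0 : 0 < e by rewrite lt_min ltr01 divr_gt0.
have [del1 del2] : del <= eta / 4 /\ del <= im w0 / 2.
  by rewrite /del !ge_min !lexx orbT.
have [e1 e2] : e <= im w0 / 2 /\ e <= 1 by rewrite /e !ge_min !lexx orbT.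
have L1 : cmod w0 + 1 <= L by rewrite /L -addrA lerDr divr_ge0 // ltW.
have L2 : 4 <= eta * L.
  rewrite mulrC -ler_pdivrMr // /L -addrA lerDl addr_ge0 // cmod_ge0 //.
have L0 : 0 < L by have := cmod_ge0 w0; lra.
pose z : C := rc (- L) + ii * rc del.
have reimz w : re (w - z) = re w + L /\ im (w - z) = im w - del.
  by rewrite /z !reimS; split; ring.
have w0I : deep_in z (2 * L) e w0.
  rewrite /deep_in; have [-> ->] := reimz w0.
  have := re_le_cmod w0; have := im_le_cmod w0; have := ler_norm (im w0).
  by have := ler_norm (re w0); have := lerNnormlW (lexx `|re w0|); split; lra.
have [K K0 KP] := crude_cauchy (mulr_gt0 (ltr0n _ 2) L0) e0 w0I.
have imp w : in_square z (2 * L) w -> 0 < im w.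
  by rewrite /in_square; have [-> ->] := reimz w; lra.
have bd w : on_square z (2 * L) w -> q <= cmod (cayley w).
  move=> wS; have wi := imp w wS.1.
  have p : 0 < cmod (w + ii) ^+ 2 by rewrite exprn_gt0 // cmod_gt0 cayley_den.
  rewrite -(@ler_pXn2r _ 2) ?nnegrE ?cmod_ge0 ?(ltW q0) //.
  (* By [cmod_cayley_sqr], this says that [1 - cmod (cayley w) ^+ 2] is at most [eta], which is
     [1 - q ^+ 2]. *)
  suff : 4 * im w <= eta * cmod (w + ii) ^+ 2.
    by rewrite -cmod_cayley_sqr // ler_pM2r // /eta; lra.
  rewrite cmod_reim reD imD re_ii im_ii addr0.
  move: wS; rewrite /on_square /in_square; have [-> ->] := reimz w.
  move: (re w) (im w) wi => x y y0 [[/andP[x1 x2] /andP[y1 y2]] H].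
  have side : L ^+ 2 <= x ^+ 2 \/ L <= y ->
      4 * y <= eta * (x ^+ 2 + (y + 1) ^+ 2).
    move=> H'; have : L * y <= x ^+ 2 + (y + 1) ^+ 2.
      by case: H' => H'; have := sqr_ge0 (L - y); have := sqr_ge0 x; nra.
    rewrite -(ler_pM2l eta0) mulrA; apply: le_trans.
    by rewrite ler_pM2r.
  case: H => H.
  - by apply: side; left; rewrite (_ : x = - L) ?sqrrN //; lra.
  - by apply: side; left; rewrite (_ : x = L) //; lra.
  - have -> : y = del by lra.
    apply: (@le_trans _ _ eta); first lra.
    rewrite -{1}[eta]mulr1 ler_pM2l //; have := sqr_ge0 x; nra.
  - by apply: side; right; lra.
have bound n : (q * cmod (f l) / cmod l) ^+ n * cmod (f l) <= K.
  pose h w := f (cayley w) ^+ n.+1 / (cayley w - 0) ^+ n.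
  have qn : 0 < q ^+ n by rewrite exprn_gt0.
  have := KP h (q ^+ n)^-1; rewrite invr_ge0 (ltW qn) => /(_ isT).
  have h1 w : in_square z (2 * L) w -> derivable h w 1.
    move=> /imp wi.
    apply: (@derivable_compC _ (fun u => f u ^+ n.+1 / (u - 0) ^+ n)).
      exact: derivable_cayley.
    by apply: derivable_powdiv => //; apply: fD; exact: cayley_disc.
  have h2 w : on_square z (2 * L) w -> cmod (h w) <= (q ^+ n)^-1.
    move=> wS; have cw := bd w wS.
    rewrite /h subr0 cmodM cmodV !cmodX -[_^-1 in leRHS]mul1r.
    apply: ler_pM; rewrite ?invr_ge0 ?exprn_ge0 ?cmod_ge0 //.
      by rewrite exprn_ile1 ?cmod_ge0 // f1 //; apply/cayley_disc/imp/wS.1.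
    rewrite lef_pV2 ?posrE //; last by rewrite exprn_gt0 // (lt_le_trans q0).
    by apply: lerXn2r; rewrite ?nnegrE ?cmod_ge0 // ltW.
  move=> /(_ h1 h2); rewrite /h w0l subr0 cmodM cmodV !cmodX ler_pdivlMr //.
  move=> H; apply: le_trans H; rewrite le_eqVlt; apply/orP; left; apply/eqP.
  by rewrite expr_div_n (exprMn n q) exprS; field; rewrite expf_neq0 // gt_eqF.
have [n] := expr_unbounded (K / cmod (f l)) ql.
by rewrite ltr_pdivrMr // ltNge bound.
Qed.

End Schwarz.

(** * Schwarz's lemma for maps into the closed tetrablock *)

Section TetrablockSchwarz.
Variable R : realType.
Local Notation C := (Cplx R).
Local Notation rc := (@rc R).
Implicit Types (f g h : C -> C) (z w l a b p : C) (e r : R).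

Lemma closure_rowP n (A : set 'rV[C]_n.+1) v : closure A v <->
  forall e, 0 < e -> exists2 u, A u & forall j, cmod (v 0 j - u 0 j) < e.
Proof.
split=> [cl e e0|H B /nbhs_ballP[/= d d0 dB]].
  have e0' : 0 < rc e by rewrite -rc0 ltr_rc.
  have [u [Au uB]] := cl _ (nbhsx_ballx v (rc e) e0').
  by exists u => // j; have := uB.2 0 j; rewrite -ltr_rc; apply.
have d_real : d = rc (re d).
  by apply: eq_reim => //; rewrite im_rc; apply: ger0_Im (ltW d0).
have [|u Au uv] := H (re d); first by rewrite -ltr_rc -d_real.
exists u; split=> //; apply: dB; split=> // i j; rewrite (ord1 i) d_real.
by have := uv j; rewrite -ltr_rc; apply.
Qed.

Lemma tripleE a b p :
  [/\ triple a b p 0 0 = a, triple a b p 0 1 = b & triple a b p 0 2 = p].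
Proof. by rewrite /triple !mxE. Qed.

(** For fixed [w] the defining expression is [(1 - x2 w) - z (x1 - x3 w)], affine in [z]; it has no
    zero in the closed disc exactly when the constant term dominates strictly. *)
Lemma tetrablockP (v : 'rV[C]_3) : tetrablock v <-> forall w, cmod w <= 1 ->
  cmod (v 0 0 - v 0 2 * w) < cmod (1 - v 0 1 * w).
Proof.
split=> [vE w w1|H z w z1 w1].
  rewrite ltNge; apply/negP => le; have [v0|v0] := eqVneq (v 0 0 - v 0 2 * w) 0.
    have := vE 0 w; rewrite cmod0 ler01 w1 => /(_ isT isT).
    rewrite (_ : _ + _ = 1 - v 0 1 * w); last by ring.
    move: le; rewrite v0 cmod0 -cmod_gt0 => le /(le_lt_trans le).
    by rewrite ltxx.
  have := vE ((1 - v 0 1 * w) / (v 0 0 - v 0 2 * w)) w; rewrite w1.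
  rewrite cmodM cmodV ler_pdivrMr ?cmod_gt0 // mul1r => /(_ le isT) /eqP; apply.
  by field.
rewrite -cmod_gt0 (_ : _ + _ = (1 - v 0 1 * w) - z * (v 0 0 - v 0 2 * w));
  last by ring.
apply: lt_le_trans (cmodB_ge _ _); rewrite subr_gt0.
apply: le_lt_trans (H w w1).
by rewrite cmodM ler_piMl // cmod_ge0.
Qed.

Lemma tetrablock_swap a b p :
  tetrablock (triple a b p) -> tetrablock (triple b a p).
Proof.
have [e0 e1 e2] := tripleE a b p; have [s0 s1 s2] := tripleE b a p.
move=> H z w z1 w1; have := H w z w1 z1; rewrite e0 e1 e2 s0 s1 s2.
by congr (_ != 0); ring.
Qed.

Lemma row3E (v : 'rV[C]_3) : v = triple (v 0 0) (v 0 1) (v 0 2).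
Proof.
apply/rowP => j; rewrite mxE; case: j => -[|[|[|//]]] j3 /=; congr (v _ _);
  exact: val_inj.
Qed.

Lemma closure_tetrablock_le (v : 'rV[C]_3) w : closure (@tetrablock R) v ->
  cmod w <= 1 -> cmod (v 0 0 - v 0 2 * w) <= cmod (1 - v 0 1 * w) /\
                 cmod (v 0 1 - v 0 2 * w) <= cmod (1 - v 0 0 * w).
Proof.
move=> /closure_rowP cl w1.
have key i j : (forall u, tetrablock u ->
      cmod (u 0 i - u 0 2 * w) < cmod (1 - u 0 j * w)) ->
    cmod (v 0 i - v 0 2 * w) <= cmod (1 - v 0 j * w).
  move=> H; apply/ler_addgt0Pr => e e0.
  (* Three coordinates enter the inequality, each perturbed by less than [e / 3]. *)
  have [|u uT uv] := cl (e / 3); first by rewrite divr_gt0.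
  have := H u uT; have := uv i; have := uv j; have := uv 2.
  have -> : v 0 i - v 0 2 * w =
    (u 0 i - u 0 2 * w) + (v 0 i - u 0 i) + - ((v 0 2 - u 0 2) * w) by ring.
  have := cmodD (u 0 i - u 0 2 * w + (v 0 i - u 0 i)) (- ((v 0 2 - u 0 2) * w)).
  have := cmodD (u 0 i - u 0 2 * w) (v 0 i - u 0 i).
  have -> : 1 - u 0 j * w = (1 - v 0 j * w) + (v 0 j - u 0 j) * w by ring.
  have := cmodD (1 - v 0 j * w) ((v 0 j - u 0 j) * w).
  have mulw s : cmod (s * w) <= cmod s by rewrite cmodM ler_piMr // cmod_ge0.
  have := mulw (v 0 2 - u 0 2); have := mulw (v 0 j - u 0 j).
  by rewrite cmodN; lra.
split; apply: key => u uT; first exact: (tetrablockP u).1.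
have /tetrablockP/(_ w w1) : tetrablock (triple (u 0 1) (u 0 0) (u 0 2)).
  by apply: tetrablock_swap; rewrite -row3E.
by have [-> -> ->] := tripleE (u 0 1) (u 0 0) (u 0 2).
Qed.

(** The weak inequalities alone do not exclude a zero of [1 - g z * w]. At [u = 0] they give
    [cmod (g z) <= 1], so Schwarz's lemma for [g] yields [cmod (g z) < 1]; then it applies to the
    fraction. *)
Lemma schwarz_fraction f g h w : cmod w <= 1 ->
  (forall z, unit_disc z ->
     [/\ derivable f z 1, derivable g z 1 & derivable h z 1]) ->
  (forall z u, unit_disc z -> cmod u <= 1 ->
     cmod (f z - h z * u) <= cmod (1 - g z * u) /\
     cmod (g z - h z * u) <= cmod (1 - f z * u)) ->
  f 0 = 0 -> g 0 = 0 -> h 0 = 0 -> forall l, unit_disc l ->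
  cmod (f l - h l * w) <= cmod l * cmod (1 - g l * w) /\ 1 - g l * w != 0.
Proof.
move=> w1 D H f0 g0 h0.
have gS z : unit_disc z -> cmod (g z) <= cmod z.
  move=> z1; apply: schwarz => // [u u1|u u1]; first by have [] := D u u1.
  have c0 : cmod (0 : C) <= 1 by rewrite cmod0 ler01.
  by have [_] := H u 0 u1 c0; rewrite !mulr0 !subr0 cmod1.
have den z : unit_disc z -> 1 - g z * w != 0.
  move=> z1; rewrite -cmod_gt0; apply: lt_le_trans (cmodB_ge _ _).
  rewrite cmod1 subr_gt0 cmodM; apply: le_lt_trans (le_lt_trans (gS z z1) z1).
  by rewrite ler_piMr // cmod_ge0.
move=> l l1; split; last exact: den.
have := @schwarz _ (fun z => (f z - h z * w) / (1 - g z * w)) _ _ _ l l1.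
rewrite cmodM cmodV ler_pdivrMr ?cmod_gt0 ?den //; apply.
- move=> z z1; have [fz gz hz] := D z z1.
  have fh := derivable_subE fz (derivable_mulE hz (@derivable_cstE _ w z)).
  have gw := derivable_subE (@derivable_cstE _ 1 z)
    (derivable_mulE gz (@derivable_cstE _ w z)).
  exact: (derivable_divE fh gw (den z z1)).
- move=> z z1; rewrite cmodM cmodV ler_pdivrMr ?cmod_gt0 ?den // mul1r.
  exact: (H z w z1 w1).1.
- by rewrite f0 h0 mul0r subr0 mul0r.
Qed.

Lemma polar z : exists2 u : C, cmod u = 1 & z = rc (cmod z) * u.
Proof.
have [->|z0] := eqVneq z 0; first by exists 1; rewrite ?cmod1 // cmod0 mul0r.
exists (z / rc (cmod z)); last by rewrite mulrC divfK // rc_eq0 cmod_eq0.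
by rewrite cmodM cmodV cmod_rc ger0_norm ?cmod_ge0 // divff // cmod_eq0.
Qed.

Lemma fraction_sup a b p r : cmod b < 1 ->
  (forall w, cmod w <= 1 -> cmod (a - p * w) <= r * cmod (1 - b * w)) ->
  (cmod (a - b^* * p) + cmod (a * b - p)) / (1 - cmod b ^+ 2) <= r.
Proof.
move=> b1 H; have S0 : 0 < 1 - cmod b ^+ 2.
  by rewrite subr_gt0 expr_lt1 // cmod_ge0.
rewrite ler_pdivrMr //.
have [u u1 Xu] := polar (a - b^* * p); have [v v1 Yv] := polar (a * b - p).
have v0 : v != 0 by rewrite -cmod_gt0 v1.
(* Multiplication by [eta] gives [a * b - p] the phase of [a - b^* * p], so that the two moduli add
   up. *)
pose eta := u / v.
have eta1 : cmod eta = 1 by rewrite cmodM cmodV u1 v1 invr1 mulr1.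
have etaJ : eta * eta^* = 1 by rewrite -cmodCK eta1 expr1n.
have den : 1 + b * eta != 0.
  rewrite -cmod_gt0 -[b * eta]opprK; apply: lt_le_trans (cmodB_ge _ _).
  by rewrite cmod1 cmodN cmodM eta1 mulr1 subr_gt0.
have denJ : cmod (eta + b^*) = cmod (1 + b * eta).
  rewrite (_ : eta + b^* = eta * (1 + b * eta)^*).
    by rewrite cmodM eta1 mul1r cmodJ.
  by rewrite rmorphD rmorph1 rmorphM mulrDr mulr1 mulrCA etaJ mulr1.
(* [w |-> (a - p w) / (1 - b w)] maps the unit circle onto the circle of centre
   [(a - b^* p) / (1 - |b|^2)] and radius [|ab - p| / (1 - |b|^2)]; this [w] is
   sent to the point of maximal modulus. *)
have := H ((eta + b^*) / (1 + b * eta)).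
rewrite cmodM cmodV denJ divff ?cmod_eq0 // lexx => /(_ isT).
rewrite (_ : a - _ = ((a - b^* * p) + (a * b - p) * eta) / (1 + b * eta));
  last by field.
rewrite (_ : 1 - _ = (1 - b * b^*) / (1 + b * eta)); last by field.
rewrite !(cmodM _ _^-1) mulrA ler_pM2r ?cmodV ?invr_gt0 ?cmod_gt0 //.
rewrite -cmodCK -rc1 -rcB cmod_rc (ger0_norm (ltW S0)).
rewrite (_ : a - b^* * p + _ * eta =
  rc (cmod (a - b^* * p) + cmod (a * b - p)) * u).
  by rewrite cmodM u1 mulr1 cmod_rc ger0_norm // addr_ge0 ?cmod_ge0.
by rewrite {1}Xu {1}Yv /eta rcD; field.
Qed.

End TetrablockSchwarz.

(** * Parameters of the interpolating function *)

Section ExtremalParameters.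
Variable R : realType.
Local Notation C := (Cplx R).
Local Notation rc := (@rc R).
Implicit Types (z w a b p u : C) (c d k r : R).

Lemma one_sub_mul_neq0 z w : cmod z <= 1 -> cmod w < 1 -> 1 - z * w != 0.
Proof.
move=> z1 w1; rewrite -cmod_gt0; apply: lt_le_trans (cmodB_ge _ _).
rewrite cmod1 subr_gt0 cmodM; apply: le_lt_trans w1.
by rewrite ler_piMl // cmod_ge0.
Qed.

(* Normal form of the extremal data: [b] and the pair [(c, d)] stand for
   [b], [(|a - b^* p|, |ab - p|)] after rotating both phases to 1. *)
Lemma extremal_parameters_normalized b c d r : cmod b < 1 -> 0 <= c -> 0 <= d ->
  0 < c + d -> r < 1 -> (c + d) / (1 - cmod b ^+ 2) <= r ->
  cmod b * (1 - cmod b ^+ 2) <= cmod (rc c - b^* * rc d) ->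
  exists k u om, let S := rc (1 - cmod b ^+ 2) in
  [/\ 0 <= k <= 1, cmod u <= r, cmod om = 1 &
    [/\ (rc c - b^* * rc d) / S =
          rc (c + d) / S * (1 - rc k) / (1 - rc k * u),
        b = (1 - rc k) * (om * u) / (1 - rc k * u) &
        (b * rc c - rc d) / S =
          rc (c + d) / S * om * (u - rc k) / (1 - rc k * u)]].
Proof.
move=> b1 c0 d0 N0 r1 Nr bS.
set S := 1 - cmod b ^+ 2; have S0 : 0 < S.
  by rewrite subr_gt0 expr_lt1 // cmod_ge0.
have NS : c + d < S.
  by move: (le_lt_trans Nr r1); rewrite ltr_pdivrMr // mul1r.
(* Here [bS] reads [cmod b * S <= cmod b * d] with [d < S], which forces [b = 0]. *)
have [c00|cn0] := eqVneq c 0.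
  subst c; rewrite add0r in N0 NS Nr *; rewrite rc0 sub0r in bS *.
  have b0 : b = 0.
    apply/eqP; rewrite -cmod_eq0; apply/negPn/negP => bn0.
    have bp : 0 < cmod b by rewrite lt_def bn0 cmod_ge0.
    move: bS; rewrite cmodN cmodM cmodJ cmod_rc (ger0_norm d0) ler_pM2l //.
    by rewrite leNgt NS.
  exists 1, 0, 1; split; rewrite ?cmod1 ?ler01 ?lexx ?cmod0 //.
    by apply: le_trans Nr; rewrite divr_ge0 // ltW.
  rewrite b0 conjC0.
  rewrite !(mul0r, mulr0, subr0, sub0r, subrr, oppr0, rc1, invr1, mulr1).
  by split=> //; rewrite mulrN1 mulNr.
have cp : 0 < c by rewrite lt_def cn0.
(* [Q] is [(c + d) * S - d * cmod (1 + b) ^+ 2], the numerator of [1 - k]. Its sign comes from [bS],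
   through [c * Q = cmod (c - b^* d) ^+ 2 - (cmod b * (c + d)) ^+ 2]. *)
pose Q := c * S - d * (2 * re b + 2 * cmod b ^+ 2).
pose m := 1 + b.
have mn0 : m != 0.
  by rewrite /m -[b]opprK -[- b]mul1r one_sub_mul_neq0 ?cmodN ?cmod1.
have mJn0 : m^* != 0 by rewrite fmorph_eq0.
have mJE : m^* = 1 + b^* by rewrite /m rmorphD rmorph1.
have cd0 : rc c - b^* * rc d != 0.
  have [->|b0] := eqVneq b 0; first by rewrite conjC0 mul0r subr0 rc_eq0.
  by rewrite -cmod_gt0; apply: lt_le_trans bS; rewrite mulr_gt0 // cmod_gt0.
have Nn0 : rc (c + d) != 0 by rewrite rc_eq0 gt_eqF.
have Sn0 : rc S != 0 by rewrite rc_eq0 gt_eqF.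
have SE : rc S = 1 - b * b^* by rewrite -cmodCK -rc1 -rcB.
(* Dividing the second desired equation by the first gives [om * u = b * (c + d) / (c - b^* * d)].
   With [om = m / m^*] this determines [u], and the first equation, linear in [k], then determines
   [k]. *)
pose k := d * cmod m ^+ 2 / ((c + d) * S).
pose u : C := m^* * b * rc (c + d) / (m * (rc c - b^* * rc d)).
have QE : rc Q = rc c * rc S - rc d * (b + b^* + 2 * (b * b^*)).
  rewrite -cmodCK /Q rcB !rcM (rcD (2 * re b)) !rcM rc_nat.
  congr (_ - _ * (_ + _)).
  by apply: eq_reim; rewrite -rc_nat !reimS; ring.
have Q0 : 0 <= Q.
  rewrite -(pmulr_rge0 _ cp).
  have -> : c * Q = cmod (rc c - b^* * rc d) ^+ 2 - (cmod b * (c + d)) ^+ 2.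
    by rewrite exprMn /Q /S !cmod_reim !reimS; ring.
  rewrite subr_ge0.
  apply: lerXn2r; rewrite ?nnegrE ?mulr_ge0 ?cmod_ge0 ?(ltW N0) //.
  by apply: le_trans bS; rewrite ler_wpM2l ?cmod_ge0 // ltW.
have k0 : 0 <= k.
  apply: divr_ge0; apply: mulr_ge0 => //; first exact: sqr_ge0.
    exact: ltW.
  exact: ltW.
have k1 : k <= 1.
  rewrite ler_pdivrMr ?mulr_gt0 // mul1r -subr_ge0.
  suff -> : (c + d) * S - d * cmod m ^+ 2 = Q by [].
  by rewrite /Q /S /m -rc1 !cmod_reim !reimS; ring.
have u1 : cmod u <= r.
  apply: le_trans Nr.
  rewrite /u !(cmodM, cmodV) cmodJ cmod_rc ger0_norm ?(ltW N0) //.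
  have mp : cmod m != 0 by rewrite cmod_eq0.
  rewrite (_ : _ / _ =
    (c + d) * (cmod b / cmod (rc c - b^* * rc d))); last first.
    by field; rewrite mp cmod_eq0 cd0.
  rewrite (ler_pM2l N0) -[_^-1 in leRHS]mul1r ler_pdivlMr // mulrAC.
  by rewrite ler_pdivrMr ?cmod_gt0 // mul1r.
have ku : 1 - rc k * u != 0.
  apply: one_sub_mul_neq0; first by rewrite cmod_rc ger0_norm.
  exact: le_lt_trans u1 r1.
have kE : rc k = rc d * (m * m^*) / (rc (c + d) * rc S).
  by rewrite /k rcM rcV (rcM d) cmodCK (rcM (c + d)).
have kuE : 1 - rc k * u = rc Q / (rc S * (rc c - b^* * rc d)).
  rewrite kE QE /u mJE rcD; rewrite mJE in mJn0; rewrite rcD in Nn0.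
  rewrite /m in mn0 *; have := Sn0; rewrite SE => Sn0'; field.
  by apply/and4P; split.
have Qn0 : rc Q != 0.
  by apply: contraNneq ku => Q00; rewrite kuE Q00 mul0r.
have k1E : 1 - rc k = rc Q / (rc (c + d) * rc S).
  rewrite kE QE mJE rcD; rewrite rcD in Nn0; rewrite /m.
  have := Sn0; rewrite SE => Sn0'; field.
  by apply/andP; split.
exists k, u, (m / m^*); split.
- by rewrite k0 k1.
- by [].
- by rewrite cmodM cmodV cmodJ divff // cmod_eq0.
- rewrite kuE k1E; split.
  + by field; do ?[apply/andP; split]; rewrite -?rcD.
  + by rewrite /u; field; do ?[apply/andP; split]; rewrite -?rcD.
  + rewrite kE /u.
    (* Over a common denominator the numerator turns out to be divisible by [rc Q], which
       cancels. *)
    rewrite (_ : _ / (_ / _) = (b * rc (c + d) ^+ 2 * rc S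
      - rc d * m ^+ 2 * (rc c - b^* * rc d)) / (rc Q * rc S)); last first.
      by field; do ?[apply/andP; split]; rewrite -?rcD.
    have -> : b * rc (c + d) ^+ 2 * rc S - rc d * m ^+ 2 * (rc c - b^* * rc d) =
        rc Q * (b * rc c - rc d).
      by rewrite QE SE rcD /m; ring.
    by field; do ?[apply/andP; split]; rewrite -?rcD.
Qed.

(** The numbers [a - b^* * p] and [a * b - p] determine [a] and [p] by a linear system of
    determinant [1 - cmod b ^+ 2] up to sign. Their phases are absorbed into [b], [Y] and [om], and
    [cmod b <= cmod a] becomes the last hypothesis of the normalized lemma. *)
Lemma extremal_parameters a b p r : cmod b < 1 -> r < 1 -> cmod b <= cmod a ->
  (cmod (a - b^* * p) + cmod (a * b - p)) / (1 - cmod b ^+ 2) <= r ->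
  exists k Y u om,
  [/\ 0 <= k <= 1, cmod Y <= r, cmod u <= r, cmod om = 1 &
    [/\ a = Y * (1 - rc k) / (1 - rc k * u),
        b = (1 - rc k) * (om * u) / (1 - rc k * u) &
        p = Y * om * (u - rc k) / (1 - rc k * u)]].
Proof.
move=> b1 r1 ba Nr.
set S := 1 - cmod b ^+ 2 in Nr; have S0 : 0 < S.
  by rewrite subr_gt0 expr_lt1 // cmod_ge0.
have Sn0 : rc S != 0 by rewrite rc_eq0 gt_eqF.
have SE : rc S = 1 - b * b^* by rewrite -cmodCK -rc1 -rcB.
have [th th1 Xth] := polar (a - b^* * p); have [v v1 Yv] := polar (a * b - p).
set c := cmod (a - b^* * p) in Xth Nr; set d := cmod (a * b - p) in Yv Nr.
have c0 : 0 <= c by exact: cmod_ge0.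
have d0 : 0 <= d by exact: cmod_ge0.
have unitJ (w : C) : cmod w = 1 -> w * w^* = 1.
  by move=> w1; rewrite -cmodCK w1 expr1n.
have thJ := unitJ _ th1; have vJ := unitJ _ v1.
have aS : a = (rc c * th - b^* * (rc d * v)) / rc S.
  by rewrite -Xth -Yv SE; field; rewrite -SE.
have pS : p = (b * (rc c * th) - rc d * v) / rc S.
  by rewrite -Xth -Yv SE; field; rewrite -SE.
(* The normalized lemma needs [0 < c + d]; otherwise [a], [p] and hence [b] vanish. *)
have [N0|Nn0] := eqVneq (c + d) 0.
  have [c00 d00] : c = 0 /\ d = 0 by lra.
  have a0 : a = 0 by rewrite aS c00 d00 !(mul0r, mulr0, subr0, rc0).
  have p0 : p = 0 by rewrite pS c00 d00 !(mul0r, mulr0, subr0, rc0).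
  have b0 : b = 0.
    apply/eqP; rewrite -cmod_eq0 eq_le cmod_ge0 andbT.
    by rewrite (le_trans ba) // a0 cmod0.
  exists 0, 0, 0, 1; rewrite cmod0 cmod1 lexx ler01.
  have r0 : 0 <= r by apply: le_trans Nr; rewrite N0 mul0r.
  by split=> //; rewrite a0 b0 p0 !(mul0r, mulr0).
have N0 : 0 < c + d by rewrite lt_def Nn0 addr_ge0.
pose ze := th * v^*; pose be := b * ze.
have ze1 : cmod ze = 1 by rewrite /ze cmodM cmodJ th1 v1 mulr1.
have zeJ := unitJ _ ze1.
have be1 : cmod be = cmod b by rewrite /be cmodM ze1 mulr1.
have aE : a = th * ((rc c - be^* * rc d) / rc S).
  rewrite {1}aS [RHS]mulrA; congr (_ / _).
  rewrite mulrBr (mulrC th) /be /ze !rmorphM /= conjCK; congr (_ - _).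
  transitivity (b^* * (rc d * v) * (th * th^*)); first by rewrite thJ mulr1.
  by ring.
have vE : th * ze^* = v.
  by rewrite /ze rmorphM /= conjCK mulrA thJ mul1r.
have bE : b = ze^* * be by rewrite /be mulrCA (mulrC ze^*) zeJ mulr1.
have pE : p = v * ((be * rc c - rc d) / rc S).
  rewrite {1}pS [RHS]mulrA; congr (_ / _).
  rewrite mulrBr (mulrC v (rc d)) /be /ze; congr (_ - _).
  transitivity (b * (rc c * th) * (v * v^*)); first by rewrite vJ mulr1.
  by ring.
have := @extremal_parameters_normalized be c d r.
rewrite be1 -/S => /(_ b1 c0 d0 N0 r1 Nr).
case=> [|k [u [om [k01 u1 om1 [E1 E2 E3]]]]].
  rewrite -ler_pdivlMr //; apply: le_trans ba _.
  by rewrite aE !cmodM cmodV th1 mul1r cmod_rc ger0_norm // ltW.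
exists k, (th * (rc (c + d) / rc S)), u, (ze^* * om); split=> //.
- by rewrite !(cmodM, cmodV) !cmod_rc th1 mul1r !ger0_norm // ltW.
- by rewrite cmodM cmodJ ze1 om1 mulr1.
- split.
  + by rewrite aE E1; ring.
  + by rewrite {1}bE E2; ring.
  + by rewrite pE E3 -vE; ring.
Qed.

End ExtremalParameters.

(** * Contractive 2 by 2 matrices and the Schur class *)

Section Contractions.
Variable R : realType.
Local Notation C := (Cplx R).
Local Notation rc := (@rc R).
Implicit Types (z w a b p u s t om : C) (k r : R).

Definition contractive2 (A : 'M[C]_2) := forall s t,
  cmod (A 0 0 * s + A 0 1 * t) ^+ 2 + cmod (A 1 0 * s + A 1 1 * t) ^+ 2 <=
  cmod s ^+ 2 + cmod t ^+ 2.

Lemma l2norm_sqr2 (v : 'cV[C]_2) :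
  l2norm v ^+ 2 = cmod (v 0 0) ^+ 2 + cmod (v 1 0) ^+ 2.
Proof.
rewrite /l2norm sqr_sqrtr; last by apply: sumr_ge0 => i _; exact: sqr_ge0.
rewrite !big_ord_recl big_ord0 addr0; congr (_ + cmod (v _ _) ^+ 2).
exact: val_inj.
Qed.

Lemma l2norm_ge0 n (v : 'cV[C]_n) : 0 <= l2norm v.
Proof. exact: sqrtr_ge0. Qed.

Lemma mulmx2E (A : 'M[C]_2) (v : 'cV[C]_2) i :
  (A *m v) i 0 = A i 0 * v 0 0 + A i 1 * v 1 0.
Proof.
rewrite mxE !big_ord_recl big_ord0 addr0.
by congr (_ + A _ _ * v _ _); exact: val_inj.
Qed.

Lemma contractive2_opnorm (A : 'M[C]_2) : contractive2 A -> opnorm A <= 1.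
Proof.
move=> cA; apply: ge_sup.
  exists (l2norm (A *m 0)), 0 => //=.
  by rewrite -(@ler_pXn2r _ 2) ?nnegrE ?l2norm_ge0 // l2norm_sqr2 !mxE cmod0; lra.
move=> _ [v /= v1 <-]; apply: le_trans v1.
rewrite -(@ler_pXn2r _ 2) ?nnegrE ?l2norm_ge0 // !l2norm_sqr2 !mulmx2E; exact: cA.
Qed.

(** The supremum in [opnorm] dominates its set only if that set is bounded above, so a crude bound
    by the moduli of the entries comes first; then [v] is rescaled to norm 1. *)
Lemma opnorm_contractive2 (A : 'M[C]_2) : opnorm A <= 1 -> contractive2 A.
Proof.
move=> A1 s t; pose v : 'cV[C]_2 := \col_i if i == 0 then s else t.
have [v0 v1] : v 0 0 = s /\ v 1 0 = t by rewrite !mxE.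
suff : l2norm (A *m v) <= l2norm v.
  rewrite -(@ler_pXn2r _ 2) ?nnegrE ?l2norm_ge0 // !l2norm_sqr2 !mulmx2E.
  by rewrite v0 v1.
have scale k (w : 'cV[C]_2) : 0 <= k -> l2norm (rc k *: w) = k * l2norm w.
  move=> k0; apply: (@pexpIrn _ 2); rewrite ?nnegrE ?mulr_ge0 ?l2norm_ge0 //.
  by rewrite exprMn !l2norm_sqr2 !mxE !cmodM !cmod_rc ger0_norm //; ring.
have bounded : has_sup [set l2norm (A *m w) |
    w in [set w : 'cV[C]_2 | l2norm w <= 1]].
  split.
    exists (l2norm (A *m 0)), 0 => //=.
    by rewrite -(@ler_pXn2r _ 2) ?nnegrE ?l2norm_ge0 // l2norm_sqr2 !mxE cmod0; lra.
  exists (cmod (A 0 0) + cmod (A 0 1) + (cmod (A 1 0) + cmod (A 1 1))).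
  move=> _ [w /= w1 <-].
  have : l2norm w ^+ 2 <= 1 by rewrite exprn_ile1 ?l2norm_ge0.
  rewrite l2norm_sqr2 => w2.
  have le1 (x y : R) : 0 <= x -> 0 <= y -> x ^+ 2 + y ^+ 2 <= 1 -> x <= 1 by nra.
  have w01 : cmod (w 0 0) <= 1 by apply: le1 w2; exact: cmod_ge0.
  have w11 : cmod (w 1 0) <= 1.
    by apply: (le1 _ (cmod (w 0 0))); rewrite ?cmod_ge0 // addrC.
  have row i : cmod ((A *m w) i 0) <= cmod (A i 0) + cmod (A i 1).
    rewrite mulmx2E; apply: le_trans (cmodD _ _) _; rewrite !cmodM.
    by apply: lerD; rewrite ler_piMr ?cmod_ge0.
  apply: le_trans (lerD (row 0) (row 1)).
  rewrite -(@ler_pXn2r _ 2) ?nnegrE ?l2norm_ge0 ?addr_ge0 ?cmod_ge0 // l2norm_sqr2.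
  have := mulr_ge0 (cmod_ge0 ((A *m w) 0 0)) (cmod_ge0 ((A *m w) 1 0)); lra.
have [vn0|vn0] := eqVneq (l2norm v) 0.
  have : l2norm v ^+ 2 = 0 by rewrite vn0 expr0n.
  rewrite l2norm_sqr2 v0 v1 => H.
  have H0 (x y : R) : x ^+ 2 + y ^+ 2 = 0 -> x = 0.
    by move=> /eqP; rewrite paddr_eq0 ?sqr_ge0 // sqrf_eq0 => /andP[/eqP].
  have s0 : s = 0 by apply/eqP; rewrite -cmod_eq0 (H0 _ _ H).
  have t0 : t = 0.
    by apply/eqP; rewrite -cmod_eq0; rewrite addrC in H; rewrite (H0 _ _ H).
  rewrite -(@ler_pXn2r _ 2) ?nnegrE ?l2norm_ge0 // !l2norm_sqr2 !mulmx2E v0 v1.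
  by rewrite s0 t0 !mulr0 addr0 cmod0 expr0n.
have vp : 0 < l2norm v by rewrite lt_def vn0 l2norm_ge0.
have vi : 0 <= (l2norm v)^-1 by rewrite invr_ge0 ltW.
have : l2norm (A *m (rc (l2norm v)^-1 *: v)) <= 1.
  apply: le_trans A1; apply: (sup_upper_bound bounded).
  by exists (rc (l2norm v)^-1 *: v) => //=; rewrite scale // mulVf.
by rewrite -scalemxAr scale // ler_pdivrMl // mulr1.
Qed.

Definition mk2 a b u v : 'M[C]_2 :=
  \matrix_(i, j) if i == 0 then if j == 0 then a else b
                 else if j == 0 then u else v.

Lemma mk2E a b u s : [/\ mk2 a b u s 0 0 = a, mk2 a b u s 0 1 = b,
  mk2 a b u s 1 0 = u & mk2 a b u s 1 1 = s].
Proof. by rewrite /mk2 !mxE. Qed.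

Lemma det2E (A : 'M[C]_2) : \det A = A 0 0 * A 1 1 - A 0 1 * A 1 0.
Proof.
rewrite (expand_det_row _ 0) !big_ord_recl big_ord0 /cofactor !det_mx11 !mxE.
rewrite /= expr0 expr1 mul1r addr0 mulN1r mulrN.
by congr (_ * A _ _ - A _ _ * A _ _); exact: val_inj.
Qed.

(* [(1, kap)] is fixed and [(kap, -1)] is mapped to a multiple of itself by the
   Blaschke factor [(u - k) / (1 - k u)]. *)
Lemma eigenframe_contraction k u s t (kap := rc (Num.sqrt k)) :
  0 <= k <= 1 -> cmod u < 1 ->
  cmod (((1 - rc k) * s + kap * (1 - u) * t) / (1 - rc k * u)) ^+ 2 +
  cmod ((kap * (1 - u) * s + (1 - rc k) * u * t) / (1 - rc k * u)) ^+ 2 <=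
  cmod s ^+ 2 + cmod t ^+ 2.
Proof.
move=> /andP[k0 k1] u1; have ku : 1 - rc k * u != 0.
  by apply: one_sub_mul_neq0 u1; rewrite cmod_rc ger0_norm.
set z1 := _ / _; set z2 := _ / _.
have kk : kap ^+ 2 = rc k by rewrite -rcX sqr_sqrtr.
(* Parseval's identity in the orthogonal frame [(1, kap)], [(kap, -1)], whose vectors have squared
   length [1 + k]. *)
have frame (p q : C) : (1 + k) * (cmod p ^+ 2 + cmod q ^+ 2) =
    cmod (p + kap * q) ^+ 2 + cmod (kap * p - q) ^+ 2.
  by rewrite /kap -{1}(sqr_sqrtr k0) !cmod_reim !reimS; ring.
have e1 : z1 + kap * z2 = s + kap * t.
  by rewrite /z1 /z2 -kk; field; rewrite kk.
have e2 : kap * z1 - z2 = (u - rc k) / (1 - rc k * u) * (kap * s - t).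
  by rewrite /z1 /z2 -kk; field; rewrite kk.
have k10 : 0 < 1 + k by lra.
rewrite -(ler_pM2l k10) !frame e1 e2 lerD2l cmodM exprMn ler_piMl ?sqr_ge0 //.
rewrite exprn_ile1 ?cmod_ge0 // cmodM cmodV ler_pdivrMr ?cmod_gt0 // mul1r.
rewrite ler_cmod_sqr -subr_ge0.
have -> : cmod (1 - rc k * u) ^+ 2 - cmod (u - rc k) ^+ 2 =
    (1 - k ^+ 2) * (1 - cmod u ^+ 2).
  by rewrite -rc1 !cmod_reim !reimS; ring.
by rewrite mulr_ge0 // subr_ge0 ?expr_le1 ?cmod_ge0 // ltW.
Qed.

Lemma schur_mk2 (e00 e01 e10 e11 : C -> C) :
  (forall z, unit_disc z -> [/\ derivable e00 z 1, derivable e01 z 1,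
     derivable e10 z 1 & derivable e11 z 1]) ->
  (forall z, unit_disc z ->
     contractive2 (mk2 (e00 z) (e01 z) (e10 z) (e11 z))) ->
  schur_class (fun z => mk2 (e00 z) (e01 z) (e10 z) (e11 z)).
Proof.
move=> D H; split=> z z1; last by apply: contractive2_opnorm; exact: H.
apply: derivable_mx => i j; have [d00 d01 d10 d11] := D z z1.
have -> : (fun w => mk2 (e00 w) (e01 w) (e10 w) (e11 w) i j) =
    if i == 0 then if j == 0 then e00 else e01 else if j == 0 then e10 else e11.
  by apply/funext => w; rewrite mxE; case: ifP => _; case: ifP.
by case: ifP => _; case: ifP.
Qed.

(** The first matrix is [G diag(sig z, om)] for the contraction [G] of [eigenframe_contraction]. The
    second, its reflection in the antidiagonal, exchanges the diagonal entries but keeps [e21],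
    which vanishes at 0, in the lower left corner; conjugation by the swap would not. *)
Lemma schur_extremal k sig rho om : 0 <= k <= 1 -> cmod sig <= 1 ->
  cmod rho <= 1 -> cmod om = 1 ->
  let e11 z := sig * z * (1 - rc k) / (1 - rc k * (rho * z)) in
  let e22 z := (1 - rc k) * (om * (rho * z)) / (1 - rc k * (rho * z)) in
  exists e12 e21 : C -> C,
  [/\ schur_class (fun z => mk2 (e11 z) (e12 z) (e21 z) (e22 z)),
      schur_class (fun z => mk2 (e22 z) (e12 z) (e21 z) (e11 z)),
      e21 0 = 0 & forall z, unit_disc z ->
        e11 z * e22 z - e12 z * e21 z =
        sig * z * om * (rho * z - rc k) / (1 - rc k * (rho * z))].
Proof.
move=> k01 sig1 rho1 om1 e11 e22; pose kap := rc (Num.sqrt k).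
have /andP[k0 k1] := k01.
pose e12 z := kap * (1 - rho * z) * om / (1 - rc k * (rho * z)).
pose e21 z := kap * (1 - rho * z) * (sig * z) / (1 - rc k * (rho * z)).
have u1 z : unit_disc z -> cmod (rho * z) < 1.
  move=> z1; rewrite cmodM; apply: le_lt_trans z1.
  by rewrite ler_piMl ?cmod_ge0.
have Y1 z s : unit_disc z -> cmod (sig * z * s) ^+ 2 <= cmod s ^+ 2.
  move=> z1; rewrite -ler_cmod_sqr cmodM ler_piMl ?cmod_ge0 // cmodM.
  by rewrite mulr_ile1 ?cmod_ge0 //; exact: ltW.
have ku z : unit_disc z -> 1 - rc k * (rho * z) != 0.
  by move=> z1; apply: one_sub_mul_neq0 (u1 z z1); rewrite cmod_rc ger0_norm.
have kk : kap ^+ 2 = rc k by rewrite -rcX sqr_sqrtr.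
have D z : unit_disc z -> [/\ derivable e11 z 1, derivable e12 z 1,
    derivable e21 z 1 & derivable e22 z 1].
  move=> z1; have di : derivable (fun w : C => w) z 1 by exact: derivable_id.
  have dc (s : C) : derivable (fun=> s) z 1 by exact: derivable_cst.
  have du := derivable_mulE (dc rho) di; have dY := derivable_mulE (dc sig) di.
  have dd := derivable_subE (dc 1) (derivable_mulE (dc (rc k)) du).
  have dk := derivable_mulE (dc kap) (derivable_subE (dc 1) du).
  split.
  - exact: (derivable_divE (derivable_mulE dY (dc (1 - rc k))) dd (ku z z1)).
  - exact: (derivable_divE (derivable_mulE dk (dc om)) dd (ku z z1)).
  - exact: (derivable_divE (derivable_mulE dk dY) dd (ku z z1)).
  - exact: (derivable_divE (derivable_mulE (dc (1 - rc k))
      (derivable_mulE (dc om) du)) dd (ku z z1)).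
exists e12, e21; split.
- apply: schur_mk2 => z z1; first by have [] := D z z1.
  move=> s t; have [-> -> -> ->] := mk2E (e11 z) (e12 z) (e21 z) (e22 z).
  apply: le_trans (_ : _ <= cmod (sig * z * s) ^+ 2 + cmod (om * t) ^+ 2) _.
    have := eigenframe_contraction (sig * z * s) (om * t) k01 (u1 z z1).
    apply: le_trans; rewrite le_eqVlt; apply/orP; left; apply/eqP.
    congr (cmod _ ^+ 2 + cmod _ ^+ 2); rewrite /e11 /e12 /e21 /e22 -/kap;
      by field; exact: ku.
  by rewrite (cmodM om) om1 mul1r lerD2r Y1.
- apply: schur_mk2 => z z1; first by have [] := D z z1.
  move=> s t; have [-> -> -> ->] := mk2E (e22 z) (e12 z) (e21 z) (e11 z).
  pose G1 := ((1 - rc k) * t + kap * (1 - rho * z) * s) / (1 - rc k * (rho * z)).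
  pose G2 := (kap * (1 - rho * z) * t + (1 - rc k) * (rho * z) * s)
               / (1 - rc k * (rho * z)).
  have GE := eigenframe_contraction t s k01 (u1 z z1).
  rewrite -/kap -/G1 -/G2 (addrC (cmod t ^+ 2)) in GE; apply: le_trans GE.
  have -> : e22 z * s + e12 z * t = om * G2.
    by rewrite /e22 /e12 /G2; field; exact: ku.
  have -> : e21 z * s + e11 z * t = sig * z * G1.
    by rewrite /e21 /e11 /G1; field; exact: ku.
  by rewrite (cmodM om) om1 mul1r addrC lerD2r Y1.
- by rewrite /e21 !mulr0 mul0r.
- by move=> z z1; rewrite /e11 /e22 /e12 /e21 -kk; field; rewrite kk ku.
Qed.

(** For [r < 1] the matrix [1 - r A diag(z, w)] is invertible, and its determinant is the polynomial
    defining the tetrablock at the triple of [r A]. These triples tend to that of [A]. *)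
Lemma contractive2_closure (A : 'M[C]_2) : contractive2 A ->
  closure (@tetrablock R) (triple (A 0 0) (A 1 1) (\det A)).
Proof.
rewrite det2E /contractive2; move: (A 0 0) (A 0 1) (A 1 0) (A 1 1) => a b c d cA.
apply/closure_rowP => e e0.
pose M := cmod a + cmod d + cmod (a * d - b * c).
have M0 : 0 <= M by rewrite !addr_ge0 ?cmod_ge0.
(* Scaling by [1 - t] or by its square moves each coordinate by at most [2 * t * M], which is below
   [e]. *)
pose t := Num.min (1 / 2) (e / (4 * (M + 1))).
have [t1 t2] : t <= 1 / 2 /\ t <= e / (4 * (M + 1)).
  by rewrite /t !ge_min !lexx orbT.
have t0 : 0 < t by rewrite lt_min !divr_gt0 // mulr_gt0 //; lra.
have tM : t * (4 * (M + 1)) <= e by rewrite -ler_pdivlMr // mulr_gt0 //; lra.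
pose r := 1 - t; have [r0 r1] : 0 <= r /\ r < 1 by rewrite /r; lra.
pose D := a * d - b * c; pose v := triple (rc r * a) (rc r * d) (rc (r ^+ 2) * D).
have [v0 v1 v2] := tripleE (rc r * a) (rc r * d) (rc (r ^+ 2) * D).
exists v; rewrite /v.
  move=> z w z1 w1; rewrite v0 v1 v2; apply/negP => /eqP det0.
  have kernel p q : p = rc r * (a * (z * p) + b * (w * q)) ->
      q = rc r * (c * (z * p) + d * (w * q)) -> p = 0 /\ q = 0.
    move=> pE qE; have := cA (z * p) (w * q).
    have le1 (x y : C) : cmod x <= 1 -> cmod (x * y) ^+ 2 <= cmod y ^+ 2.
      by move=> x1; rewrite -ler_cmod_sqr cmodM ler_piMl ?cmod_ge0.
    have := le1 z p z1; have := le1 w q w1.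
    have : cmod p ^+ 2 = r ^+ 2 * cmod (a * (z * p) + b * (w * q)) ^+ 2.
      by rewrite {1}pE cmodM cmod_rc ger0_norm // exprMn.
    have : cmod q ^+ 2 = r ^+ 2 * cmod (c * (z * p) + d * (w * q)) ^+ 2.
      by rewrite {1}qE cmodM cmod_rc ger0_norm // exprMn.
    have r21 : r ^+ 2 < 1 by rewrite expr_lt1.
    have := sqr_ge0 r; have := sqr_ge0 (cmod p); have := sqr_ge0 (cmod q).
    move=> q2 p2 r2 qr pr wq zp zw.
    have H : cmod p ^+ 2 + cmod q ^+ 2 <= r ^+ 2 * (cmod p ^+ 2 + cmod q ^+ 2).
      rewrite [leLHS](_ : _ = r ^+ 2 * (cmod (a * (z * p) + b * (w * q)) ^+ 2
        + cmod (c * (z * p) + d * (w * q)) ^+ 2)); last by rewrite mulrDr -pr -qr.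
      by apply: ler_wpM2l => //; lra.
    have H0 : cmod p ^+ 2 + cmod q ^+ 2 <= 0.
      rewrite leNgt; apply/negP => pos; move: H.
      by rewrite -[leLHS]mul1r ler_pM2r // leNgt r21.
    have pz : cmod p ^+ 2 = 0 by lra.
    have qz : cmod q ^+ 2 = 0 by lra.
    by split; apply/eqP; rewrite -cmod_eq0 -sqrf_eq0 ?pz ?qz.
  have hyp : rc r * a * z + rc r * d * w - rc r ^+ 2 * D * z * w = 1.
    by rewrite -rcX; apply/eqP; rewrite eq_sym -subr_eq0 -det0; apply/eqP; ring.
  (* If the determinant vanished, both columns of the adjugate would lie in the kernel and so be
     zero; then [(1, 0)] would lie in it as well. *)
  have [||_ az] := kernel (rc r * b * w) (1 - rc r * a * z).
  - by ring.
  - transitivity (rc r * d * w - rc r ^+ 2 * D * z * w); last by rewrite /D; ring.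
    by rewrite -{1}hyp; ring.
  have [||_ cz] := kernel (1 - rc r * d * w) (rc r * c * z).
  - transitivity (rc r * a * z - rc r ^+ 2 * D * z * w); last by rewrite /D; ring.
    by rewrite -{1}hyp; ring.
  - by ring.
  have [||/eqP] := kernel 1 0; last by rewrite oner_eq0.
  - rewrite !mulr0 addr0 mulr1; apply/esym/eqP.
    by rewrite mulrA eq_sym -subr_eq0 az.
  - by rewrite !mulr0 addr0 mulr1 mulrA cz.
have small (x s : R) (y : C) : cmod y <= M -> s <= 2 * t -> 0 <= s ->
    cmod (y - rc (1 - s) * y) < e.
  move=> yM s2 s0.
  rewrite (_ : y - _ = rc s * y); last by rewrite rcB rc1; ring.
  rewrite cmodM cmod_rc ger0_norm //.
  have : s * cmod y <= 2 * t * M by rewrite ler_pM ?cmod_ge0.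
  have : 0 <= t * M by rewrite mulr_ge0 // ltW.
  lra.
have [aM dM DM] : [/\ cmod a <= M, cmod d <= M & cmod D <= M].
  have := cmod_ge0 a; have := cmod_ge0 d; have := cmod_ge0 D.
  by rewrite /M -/D; split; lra.
have tt := sqr_ge0 t.
case=> -[|[|[|//]]] j3; rewrite !mxE /=.
- by apply: small => //; lra.
- by apply: small => //; lra.
- rewrite (_ : r ^+ 2 = 1 - (2 * t - t ^+ 2)); last by rewrite /r; ring.
  apply: small => //; first lra.
  have : t * t <= t * 1 by rewrite ler_pM2l //; lra.
  rewrite -expr2; lra.
Qed.

End Contractions.

(** * The cycle of implications *)

Theorem theorem1p2 (R : realType) (l0 a b p : Cplx R)
    (hl0 : unit_disc l0) (hl0n0 : l0 != 0)
    (hx : tetrablock (triple a b p)) :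
  [<->
   (* (1) *)
   exists phi : Cplx R -> 'rV[Cplx R]_3,
     [/\ analytic_on_disc phi,
         forall z, unit_disc z -> closure (@tetrablock R) (phi z),
         phi 0 = triple 0 0 0 & phi l0 = triple a b p];
   (* (1') *)
   exists phi : Cplx R -> 'rV[Cplx R]_3,
     [/\ analytic_on_disc phi,
         forall z, unit_disc z -> tetrablock (phi z),
         phi 0 = triple 0 0 0 & phi l0 = triple a b p];
   (* (2) *)
   Num.max
     ((cmod (a - b^* * p) + cmod (a * b - p)) / (1 - cmod b ^+ 2))
     ((cmod (b - a^* * p) + cmod (a * b - p)) / (1 - cmod a ^+ 2))
   <= cmod l0;
   (* (3) *)
   (cmod b <= cmod a /\
      (cmod (a - b^* * p) + cmod (a * b - p)) / (1 - cmod b ^+ 2) <= cmod l0)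
   \/
   (cmod a <= cmod b /\
      (cmod (b - a^* * p) + cmod (a * b - p)) / (1 - cmod a ^+ 2) <= cmod l0);
   (* (4) *)
   exists F : Cplx R -> 'M[Cplx R]_2,
     [/\ schur_class F,
         F 0 0 0 = 0 /\ F 0 1 0 = 0 /\ F 0 1 1 = 0 &
         exists A : 'M[Cplx R]_2,
           F l0 = A /\ triple a b p = triple (A 0 0) (A 1 1) (\det A)]].
Proof.
have [xE0 xE1 xE2] := tripleE a b p.
have b1 : cmod b < 1.
  have /tetrablockP/(_ 0) := tetrablock_swap hx.
  have [-> -> ->] := tripleE b a p.
  by rewrite cmod0 ler01 !mulr0 !subr0 cmod1; apply.
have a1 : cmod a < 1.
  have /tetrablockP/(_ 0) := hx; rewrite xE0 xE1 xE2.
  by rewrite cmod0 ler01 !mulr0 !subr0 cmod1; apply.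
have l0p : 0 < cmod l0 by rewrite cmod_gt0.
(* Values in the closure suffice here, so both (1) and (1') can feed this estimate. *)
have key (phi : Cplx R -> 'rV[Cplx R]_3) : analytic_on_disc phi ->
    (forall z, unit_disc z -> closure (@tetrablock R) (phi z)) ->
    phi 0 = triple 0 0 0 -> forall z w, unit_disc z -> cmod w <= 1 ->
    [/\ cmod (phi z 0 0 - phi z 0 2 * w) <= cmod z * cmod (1 - phi z 0 1 * w),
        cmod (phi z 0 1 - phi z 0 2 * w) <= cmod z * cmod (1 - phi z 0 0 * w) &
        1 - phi z 0 1 * w != 0].
  move=> phiD phiE phi0 z w z1 w1.
  have D i u : unit_disc u -> derivable (fun v => phi v 0 i) u 1.
    by move=> u1; apply: derivable_mx_entry; exact: phiD.
  have [c0 c1 c2] := tripleE (0 : Cplx R) 0 0; rewrite -phi0 in c0 c1 c2.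
  have le1 : cmod (phi z 0 0 - phi z 0 2 * w) <=
      cmod z * cmod (1 - phi z 0 1 * w) /\ 1 - phi z 0 1 * w != 0.
    apply: (@schwarz_fraction R (fun u => phi u 0 0) (fun u => phi u 0 1)
      (fun u => phi u 0 2)) => //.
      by move=> u u1; split; exact: D.
    by move=> u v u1 v1; exact: closure_tetrablock_le (phiE u u1) v1.
  have le2 : cmod (phi z 0 1 - phi z 0 2 * w) <=
      cmod z * cmod (1 - phi z 0 0 * w) /\ 1 - phi z 0 0 * w != 0.
    apply: (@schwarz_fraction R (fun u => phi u 0 1) (fun u => phi u 0 0)
      (fun u => phi u 0 2)) => //.
      by move=> u u1; split; exact: D.
    move=> u v u1 v1; have [? ?] := closure_tetrablock_le (phiE u u1) v1.
    by split.
  by split; [exact: le1.1 | exact: le2.1 | exact: le1.2].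
tfae.
- move=> [phi [phiD phiE phi0 phil]]; exists phi; split=> // z z1.
  apply/tetrablockP => w w1.
  have [le1 _ n1] := key phi phiD phiE phi0 z w z1 w1.
  (* The factor [cmod z < 1] turns the weak inequality into the strict one of the open
     tetrablock. *)
  by apply: le_lt_trans le1 _; rewrite gtr_pMl ?cmod_gt0.
- move=> [phi [phiD phiE phi0 phil]].
  have K w : cmod w <= 1 -> cmod (a - p * w) <= cmod l0 * cmod (1 - b * w) /\
      cmod (b - p * w) <= cmod l0 * cmod (1 - a * w).
    move=> w1; have [] := key phi phiD _ phi0 l0 w hl0 w1.
      by move=> z z1; apply: subset_closure; exact: phiE.
    by rewrite phil xE0 xE1 xE2.
  rewrite ge_max; apply/andP; split.
    by apply: fraction_sup b1 _ => w /K[].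
  by rewrite [a * b]mulrC; apply: fraction_sup a1 _ => w /K[].
- rewrite ge_max => /andP[h1 h2].
  by have [ba|/ltW ab] := leP (cmod b) (cmod a); [left | right].
- have solve (a' b' : Cplx R) : cmod b' < 1 -> cmod b' <= cmod a' ->
      (cmod (a' - b'^* * p) + cmod (a' * b' - p)) / (1 - cmod b' ^+ 2)
        <= cmod l0 ->
      exists e11 e12 e21 e22 : Cplx R -> Cplx R,
      [/\ schur_class (fun z => mk2 (e11 z) (e12 z) (e21 z) (e22 z)),
          schur_class (fun z => mk2 (e22 z) (e12 z) (e21 z) (e11 z)),
          [/\ e11 0 = 0, e21 0 = 0 & e22 0 = 0] &
          [/\ e11 l0 = a', e22 l0 = b' & a' * b' - e12 l0 * e21 l0 = p]].
    move=> b'1 ba h.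
    have [k [Y [u [om [k01 Yl ul om1 [aE bE pE]]]]]] :=
      extremal_parameters b'1 hl0 ba h.
    (* The slopes [Y / l0] and [u / l0] make the linear functions [sig z] and [rho z] take the
       values [Y] and [u] at [l0]. *)
    have s1 : cmod (Y / l0) <= 1 by rewrite cmodM cmodV ler_pdivrMr // mul1r.
    have r1 : cmod (u / l0) <= 1 by rewrite cmodM cmodV ler_pdivrMr // mul1r.
    have [e12 [e21 [F1 F2 e210 det]]] := schur_extremal k01 s1 r1 om1.
    have YE : Y / l0 * l0 = Y by rewrite divfK.
    have uE : u / l0 * l0 = u by rewrite divfK.
    have := det l0 hl0; rewrite YE uE -aE -bE -pE => detE.
    do 4 eexists; split; [exact: F1 | exact: F2 | | ].
    + by split=> //=; rewrite !mulr0 ?mul0r ?mulr0 ?mul0r.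
    + by split=> /=; rewrite ?YE ?uE -?aE -?bE.
  case=> -[le h].
    have [e11 [e12 [e21 [e22 [F1 _ [z1 z2 z3] [aE bE pE]]]]]] :=
      solve a b b1 le h.
    exists (fun z => mk2 (e11 z) (e12 z) (e21 z) (e22 z)).
    have E z := mk2E (e11 z) (e12 z) (e21 z) (e22 z).
    split=> //; first by have [-> _ -> ->] := E 0.
    eexists; split; first by [].
    by rewrite det2E; have [-> -> -> ->] := E l0; rewrite aE bE pE.
  (* The same construction with [a] and [b] exchanged; the reflected matrix puts [a] back in the
     upper left corner. *)
  rewrite [a * b]mulrC in h.
  have [e11 [e12 [e21 [e22 [_ F2 [z1 z2 z3] [bE aE pE]]]]]] :=
    solve b a a1 le h.
  exists (fun z => mk2 (e22 z) (e12 z) (e21 z) (e11 z)).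
  have E z := mk2E (e22 z) (e12 z) (e21 z) (e11 z).
  split=> //; first by have [-> _ -> ->] := E 0.
  eexists; split; first by [].
  rewrite det2E; have [-> -> -> ->] := E l0; rewrite aE bE [a * b]mulrC.
  by rewrite pE.
- move=> [F [[FD F1] [F00 [F10 F11]] [A [FA xA]]]].
  (* At 0 the determinant vanishes because the lower row of [F 0] does. *)
  exists (fun z => triple (F z 0 0) (F z 1 1) (\det (F z))); split.
  + move=> z z1; apply: derivable_mx => i j; have Fz := FD z z1.
    have D i' j' : derivable (fun u => F u i' j') z 1.
      exact: derivable_mx_entry.
    rewrite (ord1 i); case: j => -[|[|[|//]]] j3;
      under eq_fun do rewrite mxE /= ?det2E.
    * exact: D.
    * exact: D.
    * exact: derivable_subE (derivable_mulE (D 0 0) (D 1 1))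
        (derivable_mulE (D 0 1) (D 1 0)).
  + by move=> z z1; apply/contractive2_closure/opnorm_contractive2/F1.
  + by rewrite det2E F00 F10 F11 !mulr0 subr0.
  + by rewrite FA xA.
Qed.
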